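(* Let $n\ge 1$ and $r\ge 0$ be integers, let $a\geq 1$ be a real number, let $G\in \mathcal{G}(n,r)$ and let $D\in \mathcal{O}(G)$. Then $$R^{0}_{a+1}(D)\leq \frac{1}{2}\left[(n-1)^{a+1}+n-1+2r\cdot 2^{a}\right],$$ with equality if and only if $D\in \mathcal{G}^{*}(n,r)$.
   Context: All graphs are finite and simple. A cactus is a connected graph each of whose blocks is either an edge or a cycle; $\mathcal{G}(n,r)$ is the set of cacti with $n$ vertices and exactly $r$ cycles. An orientation of $G$ is an oriented graph obtained by replacing each edge $uv$ by exactly one of the arcs $uv$ (from $u$ to $v$) or $vu$ (from $v$ to $u$); $\mathcal{O}(G)$ is the set of orientations of $G$. For an oriented graph $D$ with arc set $A(D)$, $d^{+}_u$ and $d^{-}_u$ are the out-degree and in-degree of $u$ in $D$, and the zeroth-order general Randić index is $$R^{0}_{a+1}(D)=\frac12\sum_{uv\in A(D)}\left[(d^{+}_u)^{a}+(d^{-}_v)^{a}\right].$$ An orientation is a sink-source orientation if every vertex $w$ satisfies $d^+_w=0$ or $d^-_w=0$. $G^{0}(n,r)$ is the graph obtained from the star $K_{1,n-1}$ with center $c$ by adding $r$ pairwise vertex-disjoint edges between leaves. $G^{(1)}(n,r)$ and $G^{(2)}(n,r)$ are the orientations of $G^{0}(n,r)$ in which, respectively, all edges at $c$ are directed away from $c$ and all edges at $c$ are directed toward $c$; the $r$ remaining edges are oriented in either direction (the result is unique up to isomorphism). $G^{(3)}(4,1)$ and $G^{(4)}(4,1)$ are the two sink-source orientations of the $4$-cycle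 $C_4$. Then $\mathcal{G}^{*}(n,r)=\{G^{(1)}(n,r),G^{(2)}(n,r),G^{(3)}(4,1),G^{(4)}(4,1)\}$ if $a=1$ and $(n,r)=(4,1)$, and $\mathcal{G}^{*}(n,r)=\{G^{(1)}(n,r),G^{(2)}(n,r)\}$ otherwise. Membership in $\mathcal{G}^{*}(n,r)$ is understood up to isomorphism of oriented graphs. *)

(* Defs.v *)
From mathcomp Require Import all_boot all_order all_algebra.
From mathcomp Require Import boolp reals exp.

Set Implicit Arguments.
Unset Strict Implicit.
Unset Printing Implicit Defensive.

Import Order.TTheory GRing.Theory Num.Theory.

Section Graphs.
Variable T : finType.
Implicit Types (e d : rel T) (B : {set T}) (p : seq T).

Definition simple_graph e : Prop := symmetric e /\ irreflexive e.

(* Connectedness of the subgraph induced on [B]; vacuously true of [set0]. *)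
Definition connected_on e B : bool :=
  [forall x in B, forall y in B,
     connect [rel u v | [&& u \in B, v \in B & e u v]] x y].

Definition no_cut_vertex e B : bool :=
  [forall x in B, connected_on e (B :\ x)].

(* A maximal connected subgraph without a cut vertex is induced, so a block is
   represented by its vertex set. *)
Definition block e B : Prop :=
  maxset (fun B' => connected_on e B' && no_cut_vertex e B') B.

(* [p] lists the vertices of a cycle of the graph in cyclic order. *)
Definition graph_cycle e p : bool := [&& 2 < size p, cycle e p & uniq p].

Definition cycle_edges p : {set {set T}} := [set [set x; next p x] | x in p].

Definition induced_edges e B : {set {set T}} :=
  [set [set x; y] | x in B, y in B & e x y].

Definition is_edge e B : Prop := exists x y, e x y /\ B = [set x; y].

Definition is_cycle e B : Prop :=
  exists p, [/\ graph_cycle e p, B = [set x in p]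
              & induced_edges e B = cycle_edges p].

(* The restriction to blocks with at least two vertices only matters for the
   one-vertex graph, which counts as a cactus. *)
Definition cactus e : Prop :=
  connected_on e setT /\
  forall B, block e B -> 1 < #|B| -> is_edge e B \/ is_cycle e B.

(* Cycles are counted as subgraphs, identified by their edge sets. *)
Definition cycles e : {set {set {set T}}} :=
  [set C | `[< exists p, graph_cycle e p /\ C = cycle_edges p >]].

Definition cactus_class (n r : nat) e : Prop :=
  [/\ simple_graph e, cactus e, #|T| = n & #|cycles e| = r].

Definition orientation e d : Prop :=
  forall u v, (e u v = d u v || d v u) /\ ~~ (d u v && d v u).

Definition outdeg d (u : T) : nat := #|[set v | d u v]|.
Definition indeg d (v : T) : nat := #|[set u | d u v]|.

Definition sink_source d : Prop :=
  forall w, outdeg d w = 0 \/ indeg d w = 0.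

End Graphs.

Definition digraph_iso (T T' : finType) (d : rel T) (d' : rel T') : Prop :=
  exists2 f : T -> T', bijective f & forall x y, d x y = d' (f x) (f y).

(* The star on 0, ..., n-1 with center 0, together with the edges
   {2i+1, 2i+2} for i < r; meaningful when 2r + 1 <= n, which holds
   whenever there is a cactus with n vertices and r cycles. *)
Definition G0 (n r : nat) : rel 'I_n := fun x y =>
  ((x == 0 :> nat) (+) (y == 0 :> nat)) ||
  [exists i : 'I_r,
     ((x == i.*2.+1 :> nat) && (y == i.*2.+2 :> nat)) ||
     ((y == i.*2.+1 :> nat) && (x == i.*2.+2 :> nat))].

Definition is_G1 (n r : nat) (d : rel 'I_n) : Prop :=
  orientation (@G0 n r) d /\
  forall c x : 'I_n, c = 0 :> nat -> G0 r c x -> d c x.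

Definition is_G2 (n r : nat) (d : rel 'I_n) : Prop :=
  orientation (@G0 n r) d /\
  forall c x : 'I_n, c = 0 :> nat -> G0 r c x -> d x c.

Definition C4 : rel 'I_4 := fun x y =>
  (x.+1 %% 4 == y :> nat) || (y.+1 %% 4 == x :> nat).

Definition is_G34 (d : rel 'I_4) : Prop := orientation C4 d /\ sink_source d.

Local Open Scope ring_scope.

(* R^0_{a+1}: the index is shifted by one with respect to the exponent. *)
Definition randic0_succ (R : realType) (a : R) (T : finType) (d : rel T) : R :=
  2^-1 * \sum_(u : T) \sum_(v : T | d u v)
           ((outdeg d u)%:R `^ a + (indeg d v)%:R `^ a).

Definition Gstar (R : realType) (a : R) (n r : nat) (T : finType) (d : rel T)
  : Prop :=
  [\/ exists2 d' : rel 'I_n, is_G1 r d' & digraph_iso d d',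
      exists2 d' : rel 'I_n, is_G2 r d' & digraph_iso d d'
    | [/\ a = 1, (n, r) = (4, 1)%N
        & exists2 d' : rel 'I_4, is_G34 d' & digraph_iso d d']].

(* Main.v *)
Require Import Defs.
From mathcomp Require Import all_boot all_order all_algebra.
From mathcomp Require Import boolp reals exp.
From mathcomp Require Import convex hoelder interval_inference.
From mathcomp Require Import zify ring lra.

(** Write [f k] for [k `^ a], [n] for the number of vertices and [F] for
    [f (n - 1) + 1]. Give every arc from [u] to [v] the weight
    [f (outdeg u) + f (indeg v)]; the index is half the total weight
    ([randic_edge_sum]). Relative to a spanning tree, the edges outside the tree
    correspond to the cycles, since the cycles of a cactus are edge-disjoint, so
    there are [n - 1 + r] edges ([card_edges]). As
    [(n - 1) F + 2 r f 2 = (n - 1) ^ (a + 1) + n - 1 + 2 r 2 ^ a], the bound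
    follows by adding up two local ones ([weight_gap]):

    - an edge on no cycle weighs at most [F] ([bridge_weight]): for an arc from
      [u] to [v] the out-neighbours of [u] and the in-neighbours of [v] are
      disjoint, hence [outdeg u + indeg v <= n], and [f] is convex;

    - the edges of a cycle of length [k] weigh at most [(k - 1) F + 2 f 2]
      together ([cycle_weight]). A vertex outside the cycle has at most one
      neighbour on it, so the degrees on the cycle exceed 2 by at most [n - k]
      in total. For [k >= 4] this and the convexity of [f] suffice
      ([long_cycle_weight]). For a triangle one uses in addition that it is
      cyclic, or transitive with a middle vertex which has both an in-arc and an
      out-arc in the triangle ([transitive_triangle_weight],
      [cyclic_triangle_weight]).

    Equality means that all the local bounds are attained. A cycle of length at
    least 4 attains its bound only if [a = 1] and the graph is [C4] oriented
    alternately ([tight_C4]). Call an arc from [u] to [v]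
    full if every vertex is an out-neighbour of [u] or an in-neighbour of [v]. If
    there are no long cycles, the arcs on no cycle and the arcs from the source to
    the sink of a triangle are full; unless [u] dominates all other vertices, or
    [v] is dominated by all of them, two full arcs produce a 4-cycle
    ([tight_center]). A cactus with a vertex adjacent to all others is the graph
    [G0] ([dominated_iso]), and when this vertex is a source all the local bounds
    are attained ([center_weight]). The case of a sink reduces to that of a
    source by reversing all arcs. *)

Set Implicit Arguments.
Unset Strict Implicit.
Unset Printing Implicit Defensive.

Import Order.TTheory GRing.Theory Num.Theory.
Local Open Scope ring_scope.

(** * Powers of natural numbers *)

Section PowerSums.
Variables (R : realType) (a : R).
Hypothesis ha : 1 <= a.
Local Notation f k := (k%:R `^ a : R).

Let a_gt0 : 0 < a. Proof. exact: lt_le_trans ha. Qed.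

Lemma pow1 : f 1 = 1. Proof. by rewrite powR1. Qed.

Lemma pow_lt m n : (m < n)%N -> f m < f n.
Proof. by move=> mn; rewrite gt0_ltr_powR ?nnegrE ?ler0n ?ltr_nat. Qed.

Lemma pow_le m n : (m <= n)%N -> f m <= f n.
Proof. by rewrite leq_eqVlt => /orP[/eqP->//|/pow_lt/ltW]. Qed.

Lemma pow_2_ge2 : 2 <= f 2.
Proof. by rewrite le1r_powR // ler1n. Qed.

Lemma powR_convex (t x y : R) : 0 <= t <= 1 -> 0 <= x -> 0 <= y ->
  (t * x + (1 - t) * y) `^ a <= t * x `^ a + (1 - t) * y `^ a.
Proof.
move=> t01 x0 y0.
have /andP[t0 t1] := t01.
have := @convex_powR R a ha (Itv01 t0 t1) x y.
rewrite !convRE /=; apply.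
  by apply/classical_sets.mem_set; rewrite /= in_itv /= x0.
by apply/classical_sets.mem_set; rewrite /= in_itv /= y0.
Qed.

(** By convexity, [x] and [y] may be pushed apart, keeping their sum, until one of
    them reaches the lower bound [m]. *)
Lemma pow_merge m x y : (m <= x)%N -> (m <= y)%N ->
  f x + f y <= f m + f (x + y - m).
Proof.
move=> mx my.
have [->|xm] := eqVneq x m; first by rewrite addKn.
have [->|ym] := eqVneq y m; first by rewrite addnK addrC.
set M := (x + y - m)%N.
have xyM : x%:R + y%:R = m%:R + M%:R :> R by rewrite -!natrD; congr _%:R; lia.
have ltmx : m%:R < x%:R :> R by rewrite ltr_nat; lia.
have ltmy : m%:R < y%:R :> R by rewrite ltr_nat; lia.
pose t : R := (M%:R - x%:R) / (M%:R - m%:R).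
have tD : t * (M%:R - m%:R) = M%:R - x%:R by rewrite /t mulfVK //; lra.
have t01 : 0 <= t <= 1.
  by rewrite /t divr_ge0 ?ler_pdivrMr; lra.
have t01' : 0 <= 1 - t <= 1 by lra.
have m0 := ler0n R m; have M0 := ler0n R M.
have := lerD (powR_convex t01 m0 M0) (powR_convex t01' m0 M0).
have -> : t * m%:R + (1 - t) * M%:R = x%:R by lra.
have -> : (1 - t) * m%:R + (1 - (1 - t)) * M%:R = y%:R by lra.
by lra.
Qed.

Lemma pow_pair n x y : (0 < x)%N -> (0 < y)%N -> (x + y <= n)%N ->
  f x + f y <= f n.-1 + 1.
Proof.
move=> x0 y0 xyn; have := @pow_merge 1 x y x0 y0.
have := @pow_le (x + y - 1) n.-1 ltac:(lia); rewrite pow1; lra.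
Qed.

Lemma pow_pair_eq n x y : (0 < x)%N -> (0 < y)%N -> (x + y <= n)%N ->
  f x + f y = f n.-1 + 1 -> (x + y = n)%N.
Proof.
move=> x0 y0 xyn E; apply/eqP; rewrite eqn_leq xyn leqNgt; apply/negP => lt.
have := @pow_merge 1 x y x0 y0.
have := @pow_lt (x + y - 1) n.-1 ltac:(lia); rewrite pow1; lra.
Qed.

Lemma pow_2_2 n : (3 <= n)%N -> 2 * f 2 <= f n + 1.
Proof.
move=> n3; have := @pow_pair n.+1 2 2 isT isT n3; rewrite /=; lra.
Qed.

(** Monotonicity excludes [n > 3]. For [n = 3] and [a > 1], put
    [t = 3 `^ ((a - 1) / 4)]: then [3 `^ a = 3 t ^ 4] and [2 * 2 `^ a < 4 t ^ 3],
    because [2 ^ 4 < 3 ^ 3], while [3 t ^ 4 + 1 >= 4 t ^ 3]. *)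
Lemma pow_2_2_eq n : (3 <= n)%N -> 2 * f 2 = f n + 1 -> n = 3%N /\ a = 1.
Proof.
move=> n3 E.
have n3E : n = 3%N.
  have := @pow_pair_eq n.+1 2 2 isT isT n3; rewrite /=; lia || (move=> /(_ ltac:(lra)); lia).
split=> //; subst n; apply/eqP; rewrite eq_le ha andbT leNgt; apply/negP => a1.
pose b := (a - 1) / 4.
have b0 : 0 < b by rewrite /b divr_gt0 //; lra.
pose t : R := 3 `^ b.
have fE k : (0 < k)%N -> f k = k%:R * (k%:R `^ b) ^+ 4.
  move=> k0; rewrite -powR_mulrn ?powR_ge0 // -powRrM /b mulfVK ?pnatr_eq0 //.
  by rewrite mulr_powRB1.
move: E; rewrite !fE // -/t; set s := 2%:R `^ b => E.
have t0 : 1 < t.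
  have <- : 1 `^ b = 1 :> R by rewrite powR1.
  by rewrite gt0_ltr_powR ?nnegrE ?ltr1n.
(* [s ^ 4 = 16 `^ b] and [t ^ 3 = 27 `^ b] *)
have powX j k : (j%:R `^ b) ^+ k = (j ^ k)%:R `^ b :> R.
  by rewrite -powR_mulrn ?powR_ge0 // -powRrM mulrC powRrM powR_mulrn // natrX.
have st : (s ^+ 4) < t ^+ 3.
  by rewrite /s /t !powX gt0_ltr_powR ?nnegrE ?ler0n ?ltr_nat.
have : 0 <= (t - 1) ^+ 2 * (3 * t ^+ 2 + 2 * t + 1) by rewrite mulr_ge0 ?sqr_ge0 //; nra.
have -> : (t - 1) ^+ 2 * (3 * t ^+ 2 + 2 * t + 1) = 3 * t ^+ 4 - 4 * t ^+ 3 + 1 by ring.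
lra.
Qed.

(** Repeated merging moves all the excess over 2 to a single term. *)
Lemma sum_pow_concentrate (I : Type) (s : seq I) (D : I -> nat) :
  (0 < size s)%N -> all (fun i => 2 <= D i)%N s ->
  \sum_(i <- s) f (D i) <=
  f (2 + \sum_(i <- s) (D i - 2)) + (size s).-1%:R * f 2.
Proof.
elim: s => // i [|j s] IH _ /=.
  by rewrite !big_seq1 andbT mul0r addr0 => D2; rewrite subnKC.
move=> /andP[Di Ds]; rewrite !(big_cons _ _ i).
have /= := IH isT Ds; set S := \sum_(i <- j :: s) f _; set N := (\sum_(_ <- _) _)%N.
have := @pow_merge 2 (D i) (2 + N) Di isT.
have -> : (D i + (2 + N) - 2 = 2 + (D i - 2 + N))%N by lia.
rewrite -natr1; lra.
Qed.

End PowerSums.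

(** * Cycles as cyclic sequences *)

Section CyclicSequences.
Variable T : finType.
Implicit Types (p s : seq T) (x y u v : T).

Lemma set2_inj x y u v :
  [set x; y] = [set u; v] -> (x = u /\ y = v) \/ (x = v /\ y = u).
Proof.
move=> E; have: u \in [set x; y] by rewrite E set21.
have: v \in [set x; y] by rewrite E set22.
have: x \in [set u; v] by rewrite -E set21.
have: y \in [set u; v] by rewrite -E set22.
by rewrite !inE; do 4![case/orP=> /eqP ?]; subst; auto.
Qed.

Lemma next_neq_prev p x :
  uniq p -> (2 < size p)%N -> x \in p -> next p x != prev p x.
Proof.
move=> Up p3 xp; apply/eqP=> /(congr1 (next p)); rewrite next_prev //.
have [i s rotp] := rot_to xp.
rewrite -!(next_rot i Up); move: Up p3.
rewrite -(rot_uniq i) -(size_rot i) rotp; case: s {rotp} => [|y [|z s]] //= + _.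
rewrite eqxx !inE => /and3P[/norP[xy /norP[xz _]] _ _].
by rewrite eq_sym (negPf xy) eqxx => /eqP; rewrite eq_sym (negPf xz).
Qed.

Lemma mem_cycle_edges p x y : uniq p -> [set x; y] \in cycle_edges p ->
  x \in p /\ (y = next p x \/ y = prev p x).
Proof.
move=> Up /imsetP[z zp /set2_inj[[-> ->]|[-> ->]]]; first by auto.
by rewrite mem_next; split=> //; right; rewrite prev_next.
Qed.

Lemma next_cycle_edges p x : x \in p -> [set x; next p x] \in cycle_edges p.
Proof. by move=> xp; apply/imsetP; exists x. Qed.

Lemma prev_cycle_edges p x :
  uniq p -> x \in p -> [set x; prev p x] \in cycle_edges p.
Proof.
move=> Up xp; apply/imsetP; exists (prev p x); first by rewrite mem_prev.
by rewrite next_prev // setUC.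
Qed.

Lemma cycle_edges_inj p : uniq p -> (2 < size p)%N ->
  {in p &, injective (fun x => [set x; next p x])}.
Proof.
move=> Up p3 x y xp yp /set2_inj[[]//|[xE yE]].
have Ey : prev p x = y by rewrite xE prev_next.
by have := next_neq_prev Up p3 xp; rewrite yE Ey eqxx.
Qed.

Variable e : rel T.

Lemma card_cycle_edges p : graph_cycle e p -> #|cycle_edges p| = size p.
Proof.
case/and3P=> p3 _ Up; rewrite card_in_imset; first exact/card_uniqP.
exact: cycle_edges_inj.
Qed.

(** A cycle has only two edges at each of its vertices, so a cycle contained
    in another one is closed under taking successors along the latter. *)
Lemma cycle_edges_sub_eq p s : graph_cycle e p -> graph_cycle e s ->
  cycle_edges p \subset cycle_edges s ->
  p =i s /\ cycle_edges p = cycle_edges s.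
Proof.
case/and3P=> p3 _ Up /and3P[s3 _ Us] /subsetP sub.
have ps x : x \in p -> x \in s.
  by move=> /next_cycle_edges/sub/(mem_cycle_edges Us)[].
have nextE x : x \in p -> next s x = next p x \/ next s x = prev p x.
  move=> xp; have /sub/(mem_cycle_edges Us)[_ N] := next_cycle_edges xp.
  have /sub/(mem_cycle_edges Us)[_ P] := prev_cycle_edges Up xp.
  have := next_neq_prev Up p3 xp.
  by case: N P => -> [->|->]; rewrite ?eqxx //; auto.
have closed x : x \in p -> next s x \in p.
  by move=> xp; case: (nextE x xp) => ->; rewrite ?mem_next ?mem_prev.
case: p p3 Up sub ps nextE closed => // x0 p' p3 Up sub ps nextE closed.
have sp x : x \in s -> x \in x0 :: p'.
  have x0s := ps _ (mem_head x0 p').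
  rewrite -(fconnect_cycle (cycle_next Us) x0s) => /iter_findex <-.
  by elim: findex => [|k IH]; rewrite ?mem_head //= closed.
split; first by move=> x; apply/idP/idP; [apply: ps|apply: sp].
apply/eqP; rewrite eqEsubset; apply/andP; split; first exact/subsetP.
apply/subsetP=> _ /imsetP[x /sp xp ->].
by case: (nextE x xp) => ->; rewrite ?next_cycle_edges ?prev_cycle_edges.
Qed.

End CyclicSequences.

(** * Biconnected sets and cycles of a cactus *)

Section Biconnected.
Variables (T : finType) (e : rel T).
Hypothesis e_sym : symmetric e.
Implicit Types (A B : {set T}) (p s : seq T) (x y u v w : T).

Definition biconnected B : bool := connected_on e B && no_cut_vertex e B.

Lemma connected_onP B :
  reflect {in B &, forall x y,
             connect [rel u v | [&& u \in B, v \in B & e u v]] x y}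
          (connected_on e B).
Proof.
apply: (iffP forallP) => [H x y xB yB|H x].
  by move: (H x); rewrite xB /= => /forallP/(_ y); rewrite yB.
by apply/implyP=> xB; apply/forallP=> y; apply/implyP; apply: H.
Qed.

Lemma connected_onU A B z : z \in A -> z \in B ->
  connected_on e A -> connected_on e B -> connected_on e (A :|: B).
Proof.
move=> zA zB /connected_onP cA /connected_onP cB; apply/connected_onP.
pose ind (C : {set T}) : rel T := [rel u v | [&& u \in C, v \in C & e u v]].
have mono (C : {set T}) x y : C \subset A :|: B ->
    connect (ind C) x y -> connect (ind (A :|: B)) x y.
  move=> /subsetP CU; apply: connect_sub => u v /= /and3P[uC vC uv].
  by apply: connect1; rewrite /ind /= !CU.
have sA x y xA yA := mono A x y (subsetUl A B) (cA x y xA yA).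
have sB x y xB yB := mono B x y (subsetUr A B) (cB x y xB yB).
move=> x y; rewrite !inE => /orP[xA|xB] /orP[yA|yB]; [exact: sA| | |exact: sB].
  exact: connect_trans (sA x z xA zA) (sB z y zB yB).
exact: connect_trans (sB x z xB zB) (sA z y zA yA).
Qed.

Lemma connected_on_edge x y : e x y -> connected_on e [set x; y].
Proof.
move=> xy; apply/connected_onP=> u v; rewrite !inE.
by case/orP=> /eqP-> /orP[]/eqP->; rewrite ?connect0 // connect1 //= !inE !eqxx
  ?orbT //= e_sym.
Qed.

Lemma connected_on_path x s : path e x s -> connected_on e [set y in x :: s].
Proof.
elim: s x => [|y s IH] x /=.
  move=> _; apply/connected_onP=> u v; rewrite !inE => /eqP-> /eqP->.
  exact: connect0.
case/andP=> xy /IH cys.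
have -> : [set z in [:: x, y & s]] = [set x; y] :|: [set z in y :: s].
  by apply/setP=> z; rewrite !inE; case: (z == y); rewrite ?orbT ?orbF.
by apply: (connected_onU (z := y)); rewrite ?inE ?eqxx ?orbT ?connected_on_edge.
Qed.

Lemma no_cut_vertexD B x : biconnected B -> connected_on e (B :\ x).
Proof.
case/andP=> cB /forallP/(_ x)/implyP nB; case: (boolP (x \in B)) => // xB.
by have /setDidPl-> : [disjoint B & [set x]] by rewrite disjoint_sym disjoints1.
Qed.

(** After the deletion of a vertex, one of the two common vertices still links the
    two sets. *)
Lemma biconnectedU A B z1 z2 : z1 != z2 ->
  z1 \in A -> z1 \in B -> z2 \in A -> z2 \in B ->
  biconnected A -> biconnected B -> biconnected (A :|: B).
Proof.
move=> z12 z1A z1B z2A z2B bA bB; apply/andP; split.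
  by apply: (connected_onU z1A z1B); [case/andP: bA|case/andP: bB].
apply/forallP=> x; apply/implyP=> _; rewrite setDUl.
have [xz1|z1x] := eqVneq z1 x.
  by apply: (connected_onU (z := z2)); rewrite ?no_cut_vertexD // !inE
    ?z2A ?z2B -xz1 eq_sym z12.
by apply: (connected_onU (z := z1)); rewrite ?no_cut_vertexD // !inE ?z1A ?z1B z1x.
Qed.

(** After the deletion of a vertex of [B], one of the two neighbours of [w]
    remains. *)
Lemma biconnectedU1 B w u v : u != v -> u \in B -> v \in B -> w \notin B ->
  e w u -> e w v -> biconnected B -> biconnected (w |: B).
Proof.
move=> uv uB vB wB wu wv bB.
have cB x : x \in B -> x != w by apply: contraTneq => ->.
have ext A x : x \in A -> e w x -> connected_on e A -> connected_on e (w |: A).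
  move=> xA wx cA; have -> : w |: A = [set w; x] :|: A.
    by rewrite -setUA [[set x] :|: A]setUC; congr (_ :|: _);
       apply/setP=> z; rewrite !inE; case: eqP => [->|]; rewrite ?xA ?orbF.
  by apply: (connected_onU (z := x)); rewrite ?inE ?eqxx ?orbT ?connected_on_edge.
apply/andP; split; first by apply: (ext _ u) => //; case/andP: bB.
apply/forallP=> x; apply/implyP=> _.
have [->|xw] := eqVneq x w; first by rewrite setU1K //; case/andP: bB.
have -> : (w |: B) :\ x = w |: (B :\ x).
  by apply/setP=> z; rewrite !inE; case: (eqVneq z w) => [->|]; rewrite // eq_sym xw.
have [ux|ux] := eqVneq u x.
  by apply: (ext _ v) => //; rewrite ?no_cut_vertexD // !inE vB -ux eq_sym uv.
by apply: (ext _ u) => //; rewrite ?no_cut_vertexD // !inE uB ux.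
Qed.

(** Deleting a vertex turns a cycle into a path. *)
Lemma biconnected_cycle p : graph_cycle e p -> biconnected [set x in p].
Proof.
case/and3P=> p3 cp Up; apply/andP; split.
  case: p cp {p3 Up} => [|x s] /=.
    by move=> _; apply/connected_onP=> u v; rewrite inE.
  by rewrite rcons_path => /andP[/connected_on_path].
apply/forallP=> x; apply/implyP; rewrite inE => xp.
have [i s rotp] := rot_to xp.
have -> : [set y in p] :\ x = [set y in s].
  apply/setP=> y; rewrite !inE -(mem_rot i) rotp inE.
  case: eqVneq => //= ->; symmetry; apply: negbTE.
  by move: Up; rewrite -(rot_uniq i) rotp => /andP[].
move: cp p3; rewrite -(rot_cycle i) -(size_rot i) rotp.
by case: s {rotp} => [|y s] //= /andP[_]; rewrite rcons_path => /andP[/connected_on_path].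
Qed.

Lemma graph_cycle_next p x : graph_cycle e p -> x \in p -> e x (next p x).
Proof. by case/and3P=> _ cp _; apply: next_cycle. Qed.

Lemma graph_cycle_prev p x : graph_cycle e p -> x \in p -> e x (prev p x).
Proof. by case/and3P=> _ cp _ xp; rewrite e_sym prev_cycle. Qed.

Lemma spanning_cycle p x : graph_cycle e p -> size p = #|T| -> x \in p.
Proof.
case/and3P=> _ _ Up sp; have /eqP/setP/(_ x) : [set y in p] == [set: T].
  by rewrite eqEcard subsetT cardsT cardsE (card_uniqP Up) sp /=.
by rewrite !inE.
Qed.

Lemma cycle_edges_sub_induced p B : graph_cycle e p -> {subset p <= B} ->
  cycle_edges p \subset induced_edges e B.
Proof.
move=> gp pB; apply/subsetP=> _ /imsetP[x xp ->].
by apply/imset2P; exists x (next p x); rewrite ?inE ?pB ?mem_next ?graph_cycle_next.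
Qed.

Hypothesis e_cactus : cactus e.

(** The block containing [B] has at least three vertices, hence is itself a cycle
    [s] without chords; the edges of [p] are edges of [s], and a cycle contained in
    another one is equal to it. All that is needed about the blocks of a cactus
    follows from this. *)
Lemma biconnected_cycle_eq p B : graph_cycle e p -> {subset p <= B} ->
  biconnected B -> B = [set x in p] /\ induced_edges e B = cycle_edges p.
Proof.
move=> gp pB bB; have /and3P[p3 _ Up] := gp.
have [X Xblock BX] := maxset_exists bB.
have pX : {subset p <= X} by move=> x /pB; apply: (subsetP BX).
have X3 : (2 < #|X|)%N.
  rewrite (leq_trans p3) // -(card_uniqP Up) subset_leq_card //.
  exact/subsetP.
case: (e_cactus.2 X Xblock (ltnW X3)) => [[x [y [_ XE]]]|[s [gs XE indX]]].
  by move: X3; rewrite XE cards2; case: (_ != _).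
have [ps peE] : p =i s /\ cycle_edges p = cycle_edges s.
  by apply: (cycle_edges_sub_eq gp gs); rewrite -indX; apply: cycle_edges_sub_induced gp pX.
have XpE : X = [set x in p] by rewrite XE; apply/setP=> x; rewrite !inE ps.
have BE : B = X.
  by apply/eqP; rewrite eqEsubset BX XpE; apply/subsetP=> x; rewrite inE => /pB.
by rewrite BE -XpE peE.
Qed.

Lemma cycle_chordless p : graph_cycle e p ->
  induced_edges e [set x in p] = cycle_edges p.
Proof.
move=> gp; apply: (biconnected_cycle_eq gp _ (biconnected_cycle gp)).2.
by move=> x; rewrite inE.
Qed.

Lemma cycle_nbr p x y : graph_cycle e p -> x \in p -> y \in p -> e x y ->
  y = next p x \/ y = prev p x.
Proof.
move=> gp xp yp xy; have /and3P[_ _ Up] := gp.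
apply: (mem_cycle_edges Up (y := y) _).2; rewrite -cycle_chordless //.
by apply/imset2P; exists x y; rewrite ?inE ?xp ?yp.
Qed.

(** Otherwise the cycle together with [w] would be biconnected, and larger than
    the cycle. *)
Lemma cycle_outer_nbr p w u v : graph_cycle e p -> w \notin p ->
  u \in p -> v \in p -> e w u -> e w v -> u = v.
Proof.
move=> gp wp up vp wu wv; apply/eqP/negP=> /negP uv.
have bw : biconnected (w |: [set x in p]).
  by apply: biconnectedU1 uv _ _ _ wu wv (biconnected_cycle gp); rewrite inE.
have [|E _] := biconnected_cycle_eq gp _ bw.
  by move=> x xp; rewrite !inE xp orbT.
by move: (setU11 w [set x in p]); rewrite E inE (negPf wp).
Qed.

(** The union of the two cycles is biconnected, so each of them consists of all the
    edges induced on this union. *)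
Lemma cycle_edges_disjoint p s x y : graph_cycle e p -> graph_cycle e s -> x != y ->
  [set x; y] \in cycle_edges p -> [set x; y] \in cycle_edges s ->
  cycle_edges p = cycle_edges s.
Proof.
move=> gp gs xy Ep Es; have /and3P[_ _ Up] := gp; have /and3P[_ _ Us] := gs.
have [xp _] := mem_cycle_edges Up Ep; have [xs _] := mem_cycle_edges Us Es.
rewrite setUC in Ep; rewrite setUC in Es.
have [yp _] := mem_cycle_edges Up Ep; have [ys _] := mem_cycle_edges Us Es.
have bU : biconnected ([set x in p] :|: [set x in s]).
  by apply: (biconnectedU xy); rewrite ?inE ?biconnected_cycle.
have [|_ <-] := biconnected_cycle_eq gp _ bU.
  by move=> z zp; rewrite !inE zp.
have [|_ <-] := biconnected_cycle_eq gs _ bU => //.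
by move=> z zp; rewrite !inE zp orbT.
Qed.

End Biconnected.

(** * Counting the edges of a cactus *)

Section Edges.
Variables (T : finType) (e : rel T).
Hypothesis e_sym : symmetric e.

Definition edges : {set {set T}} := induced_edges e setT.

Lemma edgesP E : reflect (exists x y, e x y /\ E = [set x; y]) (E \in edges).
Proof.
apply: (iffP imset2P) => [[x y _]|[x [y [xy ->]]]].
  by rewrite !inE => xy ->; exists x, y.
by exists x y; rewrite ?inE.
Qed.

Lemma mem_edges x y : ([set x; y] \in edges) = e x y.
Proof.
apply/edgesP/idP=> [[u [v [uv /set2_inj[[-> ->]|[-> ->]]]]]|xy] //.
  by rewrite e_sym.
by exists x, y.
Qed.

Lemma cyclesP C :
  reflect (exists p, graph_cycle e p /\ C = cycle_edges p) (C \in cycles e).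
Proof. by rewrite inE; apply: asboolP. Qed.

Lemma cycle_edges_sub p : graph_cycle e p -> cycle_edges p \subset edges.
Proof. by move=> gp; apply: cycle_edges_sub_induced gp _ => x; rewrite inE. Qed.

End Edges.

Section SpanningTree.
Variables (T : finType) (e : rel T) (c : T).
Hypothesis e_sym : symmetric e.
Hypothesis e_irr : irreflexive e.

(** The rank is the distance to the root, and a parent is the last but one vertex
    of a shortest path from the root. *)
Lemma exists_parent : connected_on e setT ->
  exists (rho : T -> nat) (par : T -> T),
    forall v, v != c -> e v (par v) /\ (rho (par v) < rho v)%N.
Proof.
move=> /connected_onP ce.
pose P v k := `[< exists s, [/\ path e c s, last c s = v & size s = k] >].
have exP v : exists k, P v k.
  have /connectP[s ps ls] := ce c v (in_setT _) (in_setT _).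
  exists (size s); apply/asboolP; exists s; split=> //.
  by apply: sub_path ps => x y /= /and3P[].
pose rho v := ex_minn (exP v).
exists rho, (fun v => odflt v [pick w | e v w && (rho w < rho v)%N]) => v vc.
case: pickP => [w /andP[]//|no]; exfalso.
have : P v (rho v) by rewrite /rho; case: ex_minnP.
case/asboolP=> s; case/lastP: s => [[_ E]|s w [ps]].
  by rewrite -E eqxx in vc.
rewrite last_rcons size_rcons => wv ss; subst w.
move: ps; rewrite rcons_path => /andP[ps ev].
move: (no (last c s)); rewrite e_sym ev /= -ss ltnS => /negP[].
rewrite {1}/rho; case: ex_minnP => k _; apply.
by apply/asboolP; exists s.
Qed.

Variables (rho : T -> nat) (par : T -> T).
Hypothesis parP : forall v, v != c -> e v (par v) /\ (rho (par v) < rho v)%N.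

Definition tree_edges : {set {set T}} := [set [set v; par v] | v in [set~ c]].

Lemma tree_edge_parent x y : [set x; y] \in tree_edges ->
  (x != c /\ y = par x) \/ (y != c /\ x = par y).
Proof.
by case/imsetP=> v; rewrite !inE => vc /set2_inj[[-> ->]|[-> ->]]; auto.
Qed.

Lemma tree_edges_sub : tree_edges \subset edges e.
Proof.
apply/subsetP=> _ /imsetP[v vc ->]; rewrite mem_edges //.
by rewrite !inE in vc; case: (parP vc).
Qed.

Lemma card_tree_edges : #|tree_edges| = #|T|.-1.
Proof.
rewrite card_in_imset; first by rewrite cardsC1.
move=> u v; rewrite !inE => uc vc /set2_inj[[]//|[uE vE]].
have [_ lu] := parP uc; have [_ lv] := parP vc.
by move: lu lv; rewrite vE -uE => lu /(ltn_trans lu); rewrite ltnn.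
Qed.

(** At a vertex of largest rank on a cycle, both edges of the cycle cannot lead
    to the parent. *)
Lemma cycle_nontree_edge p : graph_cycle e p ->
  exists2 x, x \in p & [set x; next p x] \notin tree_edges.
Proof.
case/and3P=> p3 _ Up.
case: (boolP (all (fun x => [set x; next p x] \in tree_edges) p)); last first.
  by case/allPn=> x; exists x.
move/allP=> tp; exfalso.
have [x0 x0p] : exists x0, x0 \in p.
  by case: p p3 {Up tp} => // x s; exists x; rewrite mem_head.
have [x xp xmax] := @arg_maxnP _ x0 [in p] rho x0p.
have low y : y \in p -> [set x; y] \in tree_edges -> y = par x.
  move=> yp /tree_edge_parent[[]//|[yc xE]].
  by have [_] := parP yc; rewrite -xE ltnNge => /negP[]; apply: xmax.
have nE : next p x = par x by apply: low; rewrite ?mem_next ?tp.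
have pE : prev p x = par x.
  apply: low; rewrite ?mem_prev //.
  by rewrite setUC -{2}(next_prev Up x) tp ?mem_prev.
by have := next_neq_prev Up p3 xp; rewrite nE pE eqxx.
Qed.

Let t : rel T := [rel u v | [set u; v] \in tree_edges].

Lemma tree_connect x y : connect t x y.
Proof.
have tc : connect_sym t by apply: sym_connect_sym => u v; rewrite /t /= setUC.
have toc v : connect t v c.
  elim: {v}_.+1 {-2}v (ltnSn (rho v)) => // k IH v; rewrite ltnS => vk.
  have [->|vc] := eqVneq v c; first exact: connect0.
  have [_ lv] := parP vc; apply: connect_trans (IH (par v) (leq_trans lv vk)).
  by apply: connect1; apply/imsetP; exists v; rewrite ?inE.
by apply: connect_trans (toc x) _; rewrite tc.
Qed.

Lemma fundamental_cycle x y : e x y -> [set x; y] \notin tree_edges ->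
  exists p, [/\ graph_cycle e p, [set x; y] \in cycle_edges p
              & cycle_edges p \subset [set x; y] |: tree_edges].
Proof.
move=> xy ntxy; have /connectP[s0 ps0 ys0] := tree_connect x y.
case: (shortenP ps0) ys0 => s ps Us _ yE; rewrite {s0 ps0} in yE *.
have te u v : t u v -> e u v.
  by move=> tuv; rewrite -(mem_edges e_sym); apply: (subsetP tree_edges_sub).
pose t' := [rel u v | t u v || ((u == y) && (v == x))].
have ct' : cycle t' (x :: s).
  rewrite /= rcons_path -yE /= !eqxx orbT andbT.
  by apply: sub_path ps => u v uv /=; rewrite uv.
have gp : graph_cycle e (x :: s).
  apply/and3P; split=> //.
    case: s ps yE {Us ct'} => [_ /= yE|z [|w s]] //=; first by rewrite yE e_irr in xy.
    by rewrite andbT => xz yE; move: ntxy; rewrite yE /t /= in xz *; rewrite xz.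
  apply: sub_cycle ct' => u v /= /orP[/te//|/andP[/eqP-> /eqP->]].
  by rewrite e_sym.
have sub : cycle_edges (x :: s) \subset [set x; y] |: tree_edges.
  apply/subsetP=> _ /imsetP[u up ->].
  have /= /orP[tu|/andP[/eqP-> /eqP->]] := next_cycle ct' up.
    by apply/setUP; right.
  by rewrite setUC !inE eqxx.
(* The new edge is on the cycle, since the tree contains no cycle. *)
exists (x :: s); split=> //.
have [u up nu] := cycle_nontree_edge gp.
have := subsetP sub _ (next_cycle_edges up).
by rewrite !inE (negPf nu) orbF => /eqP<-; apply: next_cycle_edges.
Qed.

End SpanningTree.

Section CactusCount.
Variables (T : finType) (e : rel T).
Hypothesis e_simple : simple_graph e.
Hypothesis e_cactus : cactus e.

Let e_sym : symmetric e := e_simple.1.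
Let e_irr : irreflexive e := e_simple.2.

Lemma cycles_disjoint C1 C2 E : C1 \in cycles e -> C2 \in cycles e ->
  E \in C1 -> E \in C2 -> C1 = C2.
Proof.
move=> /cyclesP[p [gp ->]] /cyclesP[s [gs ->]] Ep.
have /edgesP[x [y [xy EE]]] := subsetP (cycle_edges_sub gp) _ Ep.
rewrite EE in Ep *; apply: (cycle_edges_disjoint e_sym e_cactus gp gs) Ep.
by apply: contraTneq xy => ->; rewrite e_irr.
Qed.

Lemma trivIset_cycles : trivIset (cycles e).
Proof.
apply/trivIsetP=> C1 C2 C1c C2c; apply: contraNT => /pred0Pn[E /andP[/= E1 E2]].
by rewrite (cycles_disjoint C1c C2c E1 E2).
Qed.

Lemma cover_cycles_sub : cover (cycles e) \subset edges e.
Proof. by apply/bigcupsP=> _ /cyclesP[p [gp ->]]; apply: cycle_edges_sub. Qed.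

(** Relative to a spanning tree, the non-tree edges form a transversal of the
    set of cycles: each of them lies in its fundamental cycle, which contains no
    other non-tree edge, and is the only cycle through it. *)
Lemma card_edges : #|edges e| = (#|T|.-1 + #|cycles e|)%N.
Proof.
have [T0|/card_gt0P[c _]] := posnP #|T|.
  have noT (x : T) : False by have := card0_eq T0 x.
  have -> : edges e = set0.
    by apply/setP=> E; rewrite inE; apply/edgesP=> -[x]; case: (noT x).
  have -> : cycles e = set0.
    apply/setP=> C; rewrite [RHS]inE; apply/cyclesP=> -[p [/and3P[p3 _ _] _]].
    by case: p p3 => // x; case: (noT x).
  by rewrite T0 !cards0.
have [rho [par parP]] := exists_parent c e_sym e_cactus.1.
set TE := tree_edges c par.
have TEsub : TE \subset edges e := tree_edges_sub e_sym parP.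
have partC : partition (cycles e) (cover (cycles e)).
  rewrite /partition eqxx trivIset_cycles /=; apply/negP=> /cyclesP[p [gp E]].
  have /and3P[p3 _ _] := gp.
  by move: p3; rewrite -(card_cycle_edges gp) -E cards0.
have trans : is_transversal (edges e :\: TE) (cycles e) (cover (cycles e)).
  apply/and3P; split=> //.
    apply/subsetP=> E; rewrite inE => /andP[ntE /edgesP[x [y [xy EE]]]].
    rewrite EE in ntE *.
    have [p [gp Ep _]] := fundamental_cycle e_sym e_irr parP xy ntE.
    by apply/bigcupP; exists (cycle_edges p) => //; apply/cyclesP; exists p.
  apply/forallP=> C; apply/implyP=> Cc; have /cyclesP[p [gp CE]] := Cc.
  have [x xp ntx] := cycle_nontree_edge parP gp.
  have [s [gs xs sub]] :=
    fundamental_cycle e_sym e_irr parP (graph_cycle_next gp xp) ntx.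
  have sC : cycle_edges s \in cycles e by apply/cyclesP; exists s.
  have Cs : C = cycle_edges s.
    by apply: (cycles_disjoint Cc sC (E := [set x; next p x])) => //;
      rewrite CE next_cycle_edges.
  apply/cards1P; exists [set x; next p x]; apply/setP=> E; rewrite !inE.
  apply/andP/eqP=> [[/andP[nE _]]|->].
    by rewrite Cs => /(subsetP sub); rewrite !inE (negPf nE) orbF => /eqP.
  by rewrite ntx mem_edges // graph_cycle_next // Cs.
rewrite -(card_transversal trans) -(card_tree_edges parP).
by rewrite -(cardsID TE (edges e)) (setIidPr TEsub).
Qed.

End CactusCount.

(** * Arc weights and the local bounds *)

Section ClosingEdge.
Variables (T : finType) (e : rel T).

Lemma prev_head (x : T) s : x \notin s -> prev (x :: s) x = last x s.
Proof.
rewrite /prev; elim: s {4 5}x => [|z s IH] y /=; first by rewrite eqxx.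
by rewrite inE => /norP[/negPf-> /IH].
Qed.

Lemma closing_edge_covered (x : T) s :
  graph_cycle e (x :: s) -> [set x; last x s] \in cover (cycles e).
Proof.
move=> gp; have /and3P[_ _ Up] := gp; apply/bigcupP; exists (cycle_edges (x :: s)).
  by apply/cyclesP; exists (x :: s).
by rewrite -prev_head; [apply: prev_cycle_edges; rewrite ?mem_head|case/andP: Up].
Qed.

End ClosingEdge.

Section Orientation.
Variables (T : finType) (e d : rel T).
Hypothesis e_simple : simple_graph e.
Hypothesis e_cactus : cactus e.
Hypothesis d_or : orientation e d.

Let e_sym : symmetric e := e_simple.1.
Let e_irr : irreflexive e := e_simple.2.

Lemma or_edge x y : e x y = d x y || d y x. Proof. exact: (d_or x y).1. Qed.

Lemma or_arc x y : d x y -> e x y. Proof. by rewrite or_edge => ->. Qed.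

Lemma or_asym x y : d x y -> d y x = false.
Proof. by move=> xy; have := (d_or x y).2; rewrite xy => /negPf. Qed.

Lemma arc_neq x y : d x y -> x != y.
Proof. by move/or_arc; apply: contraTneq => ->; rewrite e_irr. Qed.

Lemma edge_neq x y : e x y -> x != y.
Proof. by apply: contraTneq => ->; rewrite e_irr. Qed.

Lemma edges_arcP E : E \in edges e -> exists x y, d x y /\ E = [set x; y].
Proof.
case/edgesP=> x [y [+ ->]]; rewrite or_edge => /orP[xy|yx]; first by exists x, y.
by exists y, x; rewrite setUC.
Qed.

Definition deg x := #|[set y | e x y]|.

Lemma deg_out_in x : (outdeg d x + indeg d x = deg x)%N.
Proof.
rewrite /outdeg /indeg /deg -[RHS](cardsID [set y | d x y]).
congr (_ + _)%N; apply: eq_card => y; rewrite !inE or_edge.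
  by case: (d x y); rewrite ?andbF.
by case: (boolP (d x y)) => // /or_asym ->.
Qed.

Lemma outdeg_gt0 x y : d x y -> (0 < outdeg d x)%N.
Proof. by move=> xy; apply/card_gt0P; exists y; rewrite inE. Qed.

Lemma indeg_gt0 x y : d x y -> (0 < indeg d y)%N.
Proof. by move=> xy; apply/card_gt0P; exists x; rewrite inE. Qed.

(** Otherwise [z] would close a triangle with the edge from [x] to [y]. *)
Lemma bridge_no_common x y z : d x y -> [set x; y] \notin cover (cycles e) ->
  d x z -> d z y -> False.
Proof.
move=> xy /negP br xz zy; apply: br.
apply: (@closing_edge_covered _ _ x [:: z; y]).
rewrite /graph_cycle /= !inE (or_arc xz) (or_arc zy) e_sym (or_arc xy) /=.
by rewrite negb_or !arc_neq.
Qed.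

Lemma bridge_degrees x y : d x y -> [set x; y] \notin cover (cycles e) ->
  (outdeg d x + indeg d y <= #|T|)%N.
Proof.
move=> xy br; rewrite /outdeg /indeg -cardsUI.
suff -> : [set v | d x v] :&: [set u | d u y] = set0.
  by rewrite cards0 addn0 max_card.
apply/setP=> z; rewrite !inE; apply/negP=> /andP[].
exact: bridge_no_common br.
Qed.

Lemma cycle_deg p x : graph_cycle e p -> x \in p ->
  deg x = (2 + #|[set y | e x y && (y \notin p)]|)%N.
Proof.
move=> gp xp; have /and3P[p3 _ Up] := gp.
have -> : 2%N = #|[set next p x; prev p x]|.
  by rewrite cards2 next_neq_prev.
rewrite /deg -(cardsID [set y in p]); congr (_ + _)%N; apply: eq_card => y.
  rewrite !inE; apply/andP/orP=> [[xy yp]|[]/eqP->].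
  - by case: (cycle_nbr e_sym e_cactus gp xp yp xy) => ->; rewrite eqxx; auto.
  - by rewrite mem_next graph_cycle_next.
  by rewrite mem_prev graph_cycle_prev.
by rewrite !inE andbC.
Qed.

(** The excess of the degrees over 2 counts the edges leaving the cycle, and each
    outer vertex receives at most one of them. *)
Lemma cycle_deg_sum p : graph_cycle e p ->
  (\sum_(x <- p) (deg x - 2) <= #|T| - size p)%N.
Proof.
move=> gp; have /and3P[p3 _ Up] := gp.
have -> : (\sum_(x <- p) (deg x - 2) =
    \sum_(x in p) \sum_(y | y \notin p) e x y)%N.
  rewrite -big_uniq //= big_seq [RHS]big_seq; apply: eq_bigr => x xp.
  rewrite (cycle_deg gp xp) addKn -sum1_card big_mkcond [RHS]big_mkcond /=.
  by apply: eq_bigr => y _; rewrite inE andbC; case: (y \notin p); case: (e x y).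
rewrite exchange_big /=.
have -> : (#|T| - size p = \sum_(y | y \notin p) 1)%N.
  by rewrite sum1_card -(card_uniqP Up) -(cardC (mem p)) addKn.
apply: leq_sum => y yp.
case: (pickP [pred x | (x \in p) && e x y]) => [x /= /andP[xp xy]|no]; last first.
  by rewrite big1 // => x xp; have := no x; rewrite /= xp /= => ->.
rewrite (bigD1 x) //= big1 ?addn0 ?leq_b1 // => z /andP[zp zx].
apply/eqP; rewrite eqb0; apply/negP=> zy; move/eqP: zx; apply.
by apply: (cycle_outer_nbr e_sym e_cactus gp yp); rewrite // e_sym.
Qed.

Lemma cycle_size p : graph_cycle e p -> (size p <= #|T|)%N.
Proof. by case/and3P=> _ _ /card_uniqP <-; apply: max_card. Qed.

Lemma triangle_deg x y z : graph_cycle e [:: x; y; z] ->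
  (deg x + deg y + deg z <= #|T| + 3)%N.
Proof.
move=> gp; have := cycle_deg_sum gp; have := cycle_size gp.
have := cycle_deg (x := x) gp; have := cycle_deg (x := y) gp.
have := cycle_deg (x := z) gp; rewrite !inE !eqxx !orbT.
move=> /(_ isT) zE /(_ isT) yE /(_ isT) xE.
by rewrite !big_cons big_nil /=; lia.
Qed.

Variables (R : realType) (a : R).
Hypothesis ha : 1 <= a.
Local Notation f k := (k%:R `^ a : R).
Local Notation n := #|T|.
Local Notation F := (f n.-1 + 1).

(** The share of the end [x] in the weight of the edge between [x] and [y], which is
    the arc weight [f (outdeg u) + f (indeg v)] of its orientation; meaningful for
    adjacent vertices only. *)
Definition half_weight x y : R :=
  if d x y then f (outdeg d x) else f (indeg d x).
Local Notation g := half_weight.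

(** The sum runs over the two ordered pairs of ends of [E]. *)
Definition edge_weight (E : {set T}) : R :=
  \sum_(q : T * T | e q.1 q.2 && ([set q.1; q.2] == E)) g q.1 q.2.

Lemma edge_weightE x y : e x y -> edge_weight [set x; y] = g x y + g y x.
Proof.
move=> xy; have xNy := edge_neq xy.
rewrite /edge_weight (bigD1 (x, y)) /= ?xy ?eqxx //.
rewrite (bigD1 (y, x)) /=; last first.
  by rewrite e_sym xy setUC eqxx xpair_eqE negb_and eq_sym xNy.
rewrite big1 ?addr0 // => -[u v] /= /andP[/andP[/andP[uv /eqP/set2_inj]]].
by case=> -[-> ->]; rewrite eqxx.
Qed.

Lemma arc_weightE x y : d x y ->
  edge_weight [set x; y] = f (outdeg d x) + f (indeg d y).
Proof. by move=> xy; rewrite edge_weightE ?or_arc // /g xy or_asym. Qed.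

Lemma randic_edge_sum :
  randic0_succ a d = 2^-1 * \sum_(E in edges e) edge_weight E.
Proof.
rewrite /randic0_succ; congr (_ * _).
have -> : \sum_(E in edges e) edge_weight E = \sum_u \sum_(v | e u v) g u v.
  rewrite [RHS]pair_big_dep /=.
  rewrite [RHS](partition_big (fun q : T * T => [set q.1; q.2]) (mem (edges e))) //=.
  by move=> [u v] /= uv; rewrite mem_edges.
transitivity (\sum_u \sum_v ((if d u v then f (outdeg d u) else 0) +
                             (if d v u then f (indeg d u) else 0))).
  under [RHS]eq_bigr do rewrite big_split /=.
  rewrite big_split /= [X in _ = _ + X]exchange_big -big_split /=.
  apply: eq_bigr => u _; rewrite -big_split /= big_mkcond /=.
  by apply: eq_bigr => v _; case: (d u v); rewrite ?addr0.
apply: eq_bigr => u _; rewrite [RHS]big_mkcond /=; apply: eq_bigr => v _.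
rewrite or_edge /g; case: (boolP (d u v)) => [/or_asym->|_] /=; rewrite ?addr0 ?add0r //.
Qed.

Lemma bridge_weight E : E \in edges e -> E \notin cover (cycles e) ->
  edge_weight E <= F.
Proof.
move=> /edges_arcP[x [y [xy ->]]] br.
rewrite arc_weightE // pow_pair ?(outdeg_gt0 xy) ?(indeg_gt0 xy) //.
exact: bridge_degrees.
Qed.

Lemma bridge_weight_eq x y : d x y -> [set x; y] \notin cover (cycles e) ->
  edge_weight [set x; y] = F -> (outdeg d x + indeg d y = n)%N.
Proof.
move=> xy br; rewrite arc_weightE //; apply: pow_pair_eq => //.
- exact: outdeg_gt0 xy.
- exact: indeg_gt0 xy.
exact: bridge_degrees.
Qed.

(** Regrouping by vertices: each vertex of the cycle contributes its two shares. *)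
Lemma cycle_weightE p : graph_cycle e p ->
  \sum_(E in cycle_edges p) edge_weight E =
  \sum_(x <- p) (g x (next p x) + g x (prev p x)).
Proof.
move=> gp; have /and3P[p3 _ Up] := gp.
rewrite big_imset /=; last exact: cycle_edges_inj.
rewrite -big_uniq //= [RHS]big_split /=.
transitivity (\sum_(x <- p) (g x (next p x) + g (next p x) x)).
  by rewrite big_seq [RHS]big_seq; apply: eq_bigr => x xp;
    rewrite edge_weightE ?graph_cycle_next.
rewrite big_split /=; congr (_ + _).
have pp : perm_eq p (map (next p) p).
  rewrite uniq_perm ?map_inj_in_uniq // => [x y _ _|x].
    exact: can_inj (prev_next Up) x y.
  apply/idP/mapP=> [xp|[y yp ->]]; last by rewrite mem_next.
  by exists (prev p x); rewrite ?mem_prev // next_prev.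
by rewrite [RHS](perm_big _ pp) big_map; apply: eq_bigr => x _; rewrite prev_next.
Qed.

Lemma half_weight_le x y : g x y <= f (deg x).
Proof.
by rewrite /g -deg_out_in; case: ifP => _; apply: pow_le => //; rewrite ?leq_addr ?leq_addl.
Qed.

Lemma cycle_deg_weight p : graph_cycle e p ->
  \sum_(x <- p) f (deg x) <= f (n - size p + 2) + (size p).-1%:R * f 2.
Proof.
move=> gp; have /and3P[p3 _ _] := gp.
have D2 : all (fun x => 2 <= deg x)%N p.
  by apply/allP=> x xp; rewrite (cycle_deg gp xp).
apply: le_trans (sum_pow_concentrate ha (ltn_trans _ p3) D2) _ => //.
by rewrite lerD2r pow_le // addnC leq_add2r cycle_deg_sum.
Qed.

(** The [k] vertices of the cycle contribute at most [2 f (deg x)] each, in total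
    [2 f (n - k + 2) + 2 (k - 1) f 2]. Since [f (n - k + 2) + f 2 <= F] and
    [2 f 2 <= F], this is at most [2 F + (k - 3) F + 2 f 2]; equality forces
    [2 f 2 = F], hence [n = 4] and [a = 1], and equality at every vertex. *)
Lemma long_cycle_weight p : graph_cycle e p -> (3 < size p)%N ->
  \sum_(E in cycle_edges p) edge_weight E <= (size p).-1%:R * F + 2 * f 2
  /\ (\sum_(E in cycle_edges p) edge_weight E = (size p).-1%:R * F + 2 * f 2 ->
      [/\ a = 1, n = 4%N &
          forall x, x \in p -> g x (next p x) = f (deg x)]).
Proof.
move=> gp p4; rewrite cycle_weightE //.
have pn := cycle_size gp; have W := cycle_deg_weight gp.
have n3 : (3 <= n.-1)%N by lia.
have K2 := pow_2_2 ha n3.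
have FA : f (n - size p + 2) + f 2 <= F by apply: pow_pair => //; lia.
have k3 : 1 <= (size p - 3)%:R :> R by rewrite ler1n; lia.
have sumE : (size p).-1%:R = 2 + (size p - 3)%:R :> R by rewrite -natrD; congr _%:R; lia.
rewrite sumE in W *.
have nn x : x \in p -> 0 <= 2 * f (deg x) - (g x (next p x) + g x (prev p x)).
  by move=> _; have := half_weight_le x (next p x);
     have := half_weight_le x (prev p x); lra.
have S : \sum_(x <- p) (2 * f (deg x) - (g x (next p x) + g x (prev p x))) =
   2 * \sum_(x <- p) f (deg x) - \sum_(x <- p) (g x (next p x) + g x (prev p x)).
  by rewrite big_split /= sumrN mulr_sumr.
have S0 : 0 <= \sum_(x <- p) (2 * f (deg x) - (g x (next p x) + g x (prev p x))).
  by rewrite big_seq; apply: sumr_ge0.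
rewrite S in S0.
have kK : (size p - 3)%:R * (2 * f 2) <= (size p - 3)%:R * F.
  by rewrite ler_wpM2l // lerD.
split; first by lra.
move=> Eq.
have kE : (size p - 3)%:R * (F - 2 * f 2) = 0 by lra.
have FE : 2 * f 2 = F.
  by move/eqP: kE; rewrite mulf_eq0 gt_eqF ?(lt_le_trans _ k3) //= subr_eq0 => /eqP.
have [n3E a1] := pow_2_2_eq ha n3 FE.
split=> //; first by lia.
have S1 : \sum_(x <- p) (2 * f (deg x) - (g x (next p x) + g x (prev p x))) = 0.
  by rewrite S; lra.
move=> x xp; have : 2 * f (deg x) - (g x (next p x) + g x (prev p x)) = 0.
  move/eqP: S1; rewrite big_seq psumr_eq0 // => /allP/(_ x xp).
  by rewrite xp => /eqP.
by have := half_weight_le x (next p x); have := half_weight_le x (prev p x); lra.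
Qed.

Lemma triangle_cycle x y z : e x y -> e y z -> e x z -> graph_cycle e [:: x; y; z].
Proof.
move=> xy yz xz; rewrite /graph_cycle /= !inE xy yz e_sym xz /=.
by rewrite negb_or !edge_neq.
Qed.

Lemma triangle_edges x y z : graph_cycle e [:: x; y; z] ->
  cycle_edges [:: x; y; z] = [set [set x; y]; [set y; z]; [set x; z]].
Proof.
case/and3P=> _ _ /=; rewrite !inE andbT => /andP[/norP[xy xz] yz].
have ny : next [:: x; y; z] y = z by rewrite /= eq_sym (negPf xy) eqxx.
have nz : next [:: x; y; z] z = x.
  by rewrite /= eq_sym (negPf xz) eq_sym (negPf yz) eqxx.
have nx : next [:: x; y; z] x = y by rewrite /= eqxx.
apply/setP=> E; rewrite !inE; apply/imsetP/idP=> [[u]|].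
  rewrite !inE => /or3P[]/eqP-> ->; rewrite ?nx ?ny ?nz ?[[set z; x]]setUC;
    by rewrite eqxx ?orbT.
case/orP=> [/orP[]|] /eqP->; [exists x|exists y|exists z];
  by rewrite ?inE ?eqxx ?orbT ?nx ?ny ?nz // setUC.
Qed.

Lemma triangle_weight x y z : graph_cycle e [:: x; y; z] ->
  \sum_(E in cycle_edges [:: x; y; z]) edge_weight E =
  edge_weight [set x; y] + edge_weight [set y; z] + edge_weight [set x; z].
Proof.
move=> gp; have := card_cycle_edges gp; rewrite (triangle_edges gp).
move: [set x; y] [set y; z] [set x; z] => A B C.
rewrite setUC cardsU1 cards2 !inE => ABC.
rewrite big_setU1 /=; last by move: ABC; rewrite !inE; case: (_ || _); case: eqP.
rewrite big_setU1 /= ?big_set1 ?inE; last by move: ABC; case: (A == B); case: (_ || _).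
by rewrite addrC.
Qed.

Definition transitive_triangle x y z := [&& d x y, d y z & d x z].

Lemma transitive_triangle_cycle x y z :
  transitive_triangle x y z -> graph_cycle e [:: x; y; z].
Proof. by case/and3P=> xy yz xz; apply: triangle_cycle; apply: or_arc. Qed.

Lemma transitive_triangle_edges x y z : transitive_triangle x y z ->
  [/\ [set x; y] \in cycle_edges [:: x; y; z],
      [set y; z] \in cycle_edges [:: x; y; z] &
      [set x; z] \in cycle_edges [:: x; y; z]].
Proof.
by move=> /transitive_triangle_cycle/triangle_edges ->; rewrite !inE !eqxx ?orbT.
Qed.

(** With [p] the out-degree of the source, [q] the in-degree of the sink and [s],
    [t] the two degrees of the middle vertex, the weight is
    [2 (f p + f q) + f s + f t], where [p + q + s + t <= n + 3]. Merging to
    [z = p + q - 2] and [w = s + t - 1] bounds it by [2 f z + 2 f 2 + f w + 1], with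
    [z + w <= n] and [z <= n - 1]. *)
Lemma transitive_triangle_weight x y z : transitive_triangle x y z ->
  let S := edge_weight [set x; y] + edge_weight [set y; z] + edge_weight [set x; z] in
  S <= 2 * F + 2 * f 2 /\
  (S = 2 * F + 2 * f 2 -> outdeg d y = 1%N /\ (outdeg d x + indeg d z = n.+1)%N).
Proof.
move=> tr; have gp := transitive_triangle_cycle tr.
have /and3P[xy yz xz] := tr; rewrite /= !arc_weightE //.
have := triangle_deg gp; rewrite -!deg_out_in.
have o2 : (2 <= outdeg d x)%N.
  have <- : #|[set y; z]| = 2%N by rewrite cards2 (arc_neq yz).
  by apply: subset_leq_card; apply/subsetP=> t; rewrite !inE => /orP[]/eqP->.
have i2 : (2 <= indeg d z)%N.
  have <- : #|[set x; y]| = 2%N by rewrite cards2 (arc_neq xy).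
  by apply: subset_leq_card; apply/subsetP=> t; rewrite !inE => /orP[]/eqP->.
have o1 := outdeg_gt0 yz; have i1 := indeg_gt0 xy.
move: (outdeg d x) (outdeg d y) (indeg d y) (indeg d z) (indeg d x) (outdeg d z) o2 o1 i1 i2.
move: #|T| => m p s t q u v p2 s1 t1 q2 le.
have zn : (p + q - 2 <= m.-1)%N by lia.
have wn : (p + q - 2 + (s + t - 1) <= m)%N by lia.
have final : (p + q - 2 = m.-1 -> s = 1 /\ p + q = m.+1)%N by lia.
have M1 := pow_merge ha p2 q2.
have M2 := pow_merge ha s1 t1; rewrite pow1 in M2.
have M3 := @pow_pair _ _ ha _ (p + q - 2) (s + t - 1) ltac:(lia) ltac:(lia) wn.
have M4 := pow_le ha zn.
(* [P], [Q], [S'], [T'] stand for the four terms, [Z], [W] for the merged ones. *)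
have arith (P Q S' T' Z W N K : R) : P + Q <= K + Z -> S' + T' <= 1 + W ->
    Z + W <= N + 1 -> P + T' + (S' + Q) + (P + Q) <= N + Z + 2 + 2 * K.
  by move=> *; lra.
have le2 := arith _ _ _ _ _ _ _ _ M1 M2 M3.
split; first by apply: le_trans le2 _; lra.
move=> E; rewrite E in le2.
apply: final; apply/eqP; rewrite eqn_leq zn leqNgt; apply/negP=> /(pow_lt ha); lra.
Qed.

(** Every vertex has an in-arc and an out-arc in the triangle, so it contributes at
    most [f (deg - 1) + 1]; one of the three leading terms is at most [f (n - 1)], the
    other two merge to [F], and the constant terms stay below [2 f 2 + 2]. *)
Lemma cyclic_triangle_weight x y z : d x y -> d y z -> d z x ->
  edge_weight [set x; y] + edge_weight [set y; z] + edge_weight [set x; z] <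
  2 * F + 2 * f 2.
Proof.
move=> xy yz zx; rewrite [[set x; z]]setUC !arc_weightE //.
have gp : graph_cycle e [:: x; y; z].
  by apply: triangle_cycle (or_arc xy) (or_arc yz) _; rewrite e_sym; apply: or_arc.
have := triangle_deg gp; rewrite -!deg_out_in.
have := outdeg_gt0 xy; have := outdeg_gt0 yz; have := outdeg_gt0 zx.
have := indeg_gt0 xy; have := indeg_gt0 yz; have := indeg_gt0 zx.
move: (outdeg d x) (outdeg d y) (indeg d y) (indeg d z) (indeg d x) (outdeg d z).
move: #|T| => m p q s t u v u0 t0 s0 v0 q0 p0 le.
have l1 : (p + u - 1 <= m.-1)%N by lia.
have l2 : ((q + s - 1) + (v + t - 1) <= m)%N by lia.
have [l3 l4] : (0 < q + s - 1 /\ 0 < v + t - 1)%N by lia.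
have M1 := pow_merge ha p0 u0; have M2 := pow_merge ha q0 s0.
have M3 := pow_merge ha v0 t0; rewrite !pow1 in M1 M2 M3.
have M4 := pow_le ha l1.
have M5 := pow_pair ha l3 l4 l2.
have := pow_2_ge2 ha; lra.
Qed.

(** What attaining the bound says about a cycle: either [a = 1], [n = 4] and
    the shares along the cycle are as large as the degrees allow, or the cycle is a
    transitive triangle whose source and sink have degrees as large as possible. *)
Definition tight_cycle (C : {set {set T}}) : Prop :=
  (exists p, [/\ graph_cycle e p, C = cycle_edges p, (3 < size p)%N, a = 1 & n = 4%N /\
      forall x, x \in p -> g x (next p x) = f (deg x)])
  \/ exists x y z, [/\ transitive_triangle x y z, C = cycle_edges [:: x; y; z],
        outdeg d y = 1%N & (outdeg d x + indeg d z = n.+1)%N].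

Lemma cycle_weight C : C \in cycles e ->
  \sum_(E in C) edge_weight E <= #|C|.-1%:R * F + 2 * f 2 /\
  (\sum_(E in C) edge_weight E = #|C|.-1%:R * F + 2 * f 2 -> tight_cycle C).
Proof.
case/cyclesP=> p [gp ->]; rewrite (card_cycle_edges gp).
have /and3P[p3 _ _] := gp.
case: (ltnP 3 (size p)) => [p4|p3'].
  have [le eq] := long_cycle_weight gp p4; split=> // /eq[a1 n4 H].
  by left; exists p; split.
have : size p = 3%N by lia.
case: p gp {p3 p3'} => [|x [|y [|z [|]]]] // gp _.
rewrite triangle_weight //=.
(* The cycle is determined by its three edges, so the vertices of a transitive
   triangle may be listed from source to sink. *)
have T0 x' y' z' : transitive_triangle x' y' z' ->
    [set x'; y'] |: [set [set y'; z']; [set x'; z']] =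
    [set x; y] |: [set [set y; z]; [set x; z]] ->
    edge_weight [set x; y] + edge_weight [set y; z] + edge_weight [set x; z] =
    edge_weight [set x'; y'] + edge_weight [set y'; z'] + edge_weight [set x'; z'] ->
  edge_weight [set x; y] + edge_weight [set y; z] + edge_weight [set x; z]
    <= 2 * F + 2 * f 2
  /\ (edge_weight [set x; y] + edge_weight [set y; z] + edge_weight [set x; z]
      = 2 * F + 2 * f 2 -> tight_cycle (cycle_edges [:: x; y; z])).
  move=> tr SE ->; have [le eq] := transitive_triangle_weight tr.
  split=> // /eq[oy oi]; right; exists x', y', z'; split=> //.
  rewrite !triangle_edges //; last exact: transitive_triangle_cycle.
  by rewrite -!setUA SE.
have Tc : edge_weight [set x; y] + edge_weight [set y; z] + edge_weight [set x; z]
    < 2 * F + 2 * f 2 ->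
  edge_weight [set x; y] + edge_weight [set y; z] + edge_weight [set x; z]
    <= 2 * F + 2 * f 2
  /\ (edge_weight [set x; y] + edge_weight [set y; z] + edge_weight [set x; z]
      = 2 * F + 2 * f 2 -> tight_cycle (cycle_edges [:: x; y; z])).
  by move=> lt; split; [exact: ltW|move=> E; move: lt; rewrite E ltxx].
have /and3P[_ /= /and4P[exy eyz ezx _] _] := gp.
have setC2 (u v : T) : [set u; v] = [set v; u] by rewrite setUC.
move: exy eyz ezx; rewrite !or_edge => /orP[xy|yx] /orP[yz|zy] /orP[zx|xz].
- by apply/Tc/cyclic_triangle_weight.
- by apply: (T0 x y z) => //; rewrite /transitive_triangle xy yz.
- apply: (T0 z x y); rewrite /transitive_triangle ?zx ?xy ?zy // ?(setC2 z x) ?(setC2 z y);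
    last by lra.
  by apply/setP=> E; rewrite !inE; do 3!case: (E == _).
- apply: (T0 x z y); rewrite /transitive_triangle ?xz ?zy ?xy // ?(setC2 z y);
    last by lra.
  by apply/setP=> E; rewrite !inE; do 3!case: (E == _).
- apply: (T0 y z x); rewrite /transitive_triangle ?yz ?zx ?yx // ?(setC2 z x) ?(setC2 y x);
    last by lra.
  by apply/setP=> E; rewrite !inE; do 3!case: (E == _).
- apply: (T0 y x z); rewrite /transitive_triangle ?yx ?xz ?yz // ?(setC2 y x);
    last by lra.
  by apply/setP=> E; rewrite !inE; do 3!case: (E == _).
- apply: (T0 z y x); rewrite /transitive_triangle ?zy ?yx ?zx // ?(setC2 z y) ?(setC2 y x) ?(setC2 z x);
    last by lra.
  by apply/setP=> E; rewrite !inE; do 3!case: (E == _).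
have := cyclic_triangle_weight xz zy yx; rewrite (setC2 z y) => lt.
by apply: Tc; lra.
Qed.

(** There are [n - 1 + r] edges, [r] more than the coefficient of [F] in the bound;
    this is made up for by charging [F] once less on each of the [r] cycles. *)
Lemma weight_gap :
  (n.-1%:R * F + 2 * #|cycles e|%:R * f 2) - \sum_(E in edges e) edge_weight E =
  \sum_(E in edges e :\: cover (cycles e)) (F - edge_weight E) +
  \sum_(C in cycles e) (#|C|.-1%:R * F + 2 * f 2 - \sum_(E in C) edge_weight E).
Proof.
set M : R := F.
have tI := trivIset_cycles e_simple e_cactus.
have sub := cover_cycles_sub e.
rewrite [X in _ - X](big_setID (cover (cycles e))) /= (setIidPr sub).
rewrite (big_trivIset _ tI) /= !sumrB sumr_const.
have cE : n.-1%:R = #|edges e :\: cover (cycles e)|%:R +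
    \sum_(C in cycles e) #|C|.-1%:R :> R.
  apply: (@addIr _ #|cycles e|%:R); rewrite -natrD -(card_edges e_simple e_cactus).
  rewrite -addrA -[in X in _ + (_ + X)]sum1_card natr_sum -big_split /=.
  rewrite -(cardsID (cover (cycles e))) (setIidPr sub) addnC natrD; congr (_ + _).
  rewrite -(eqP tI) natr_sum; apply: eq_bigr => C /cyclesP[p [gp ->]].
  have /and3P[p3 _ _] := gp.
  by rewrite -natrD (card_cycle_edges gp) addn1 prednK // ltnW // ltnW.
rewrite big_split /= sumr_const -mulr_suml cE -[M *+ _]mulr_natr -[(2 * _) *+ _]mulr_natr.
ring.
Qed.

End Orientation.

(** * The equality case *)

Section Extremal.
Variables (T : finType) (e d : rel T).
Hypothesis e_simple : simple_graph e.
Hypothesis e_cactus : cactus e.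
Hypothesis d_or : orientation e d.
Variables (R : realType) (a : R).
Hypothesis ha : 1 <= a.

Let e_sym : symmetric e := e_simple.1.
Let e_irr : irreflexive e := e_simple.2.

Local Notation f k := (k%:R `^ a : R).
Local Notation n := #|T|.
Local Notation F := (f n.-1 + 1).
Local Notation w := (edge_weight e d a).
Local Notation bound := (n.-1%:R * F + 2 * #|cycles e|%:R * f 2).

(** All the terms of the gap are nonnegative. *)
Lemma weight_bound :
  \sum_(E in edges e) w E <= bound /\
  (\sum_(E in edges e) w E = bound <->
   (forall E, E \in edges e -> E \notin cover (cycles e) -> w E = F) /\
   (forall C, C \in cycles e ->
      \sum_(E in C) w E = #|C|.-1%:R * F + 2 * f 2)).
Proof.
have gap := weight_gap d e_simple e_cactus a.
have br E : E \in edges e :\: cover (cycles e) -> 0 <= F - w E.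
  rewrite inE => /andP[Ec Ee]; rewrite subr_ge0.
  exact: (bridge_weight e_simple d_or ha).
have cy C : C \in cycles e -> 0 <= #|C|.-1%:R * F + 2 * f 2 - \sum_(E in C) w E.
  by move=> Cc; rewrite subr_ge0 (cycle_weight e_simple e_cactus d_or ha Cc).1.
have S1 := sumr_ge0 _ br; have S2 := sumr_ge0 _ cy.
split; first by rewrite -subr_ge0 gap addr_ge0.
split=> [Eq|[Hb Hc]].
  have /eqP : bound - \sum_(E in edges e) w E = 0 by rewrite Eq subrr.
  rewrite gap paddr_eq0 // psumr_eq0 // psumr_eq0 // => /andP[/allP B /allP C].
  split=> [E Ee Ec|D Dc].
    have := B E (mem_index_enum _); rewrite inE Ec Ee /= subr_eq0.
    by move/eqP.
  by have := C D (mem_index_enum _); rewrite Dc /= subr_eq0 => /eqP.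
apply/esym/eqP; rewrite -subr_eq0 gap !big1 ?addr0 // => [C Cc|E].
  by rewrite Hc // subrr.
by rewrite inE => /andP[Ec Ee]; rewrite Hb // subrr.
Qed.

Definition full_arc u v := d u v /\ forall z, d u z || d z v.

Lemma full_arc_card u v : d u v ->
  (n + #|[set z | d u z] :&: [set z | d z v]| <= outdeg d u + indeg d v)%N ->
  full_arc u v.
Proof.
move=> uv le; split=> // z.
have : [set z | d u z] :|: [set z | d z v] == setT.
  rewrite eqEcard subsetT cardsT -(leq_add2r #|[set z | d u z] :&: [set z | d z v]|).
  by rewrite cardsUI.
by move/eqP/setP/(_ z); rewrite !inE.
Qed.

Lemma out_all c : (forall z, z != c -> d c z) <-> outdeg d c = n.-1.
Proof.
have sub : [set z | d c z] \subset [set~ c].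
  apply/subsetP=> z; rewrite !inE => /(arc_neq e_simple d_or).
  by rewrite eq_sym.
rewrite /outdeg -(cardsC1 c); split=> [all|/eqP].
  apply/eqP; rewrite eqn_leq subset_leq_card //=; apply: subset_leq_card.
  by apply/subsetP=> z; rewrite !inE => /all.
move=> eqc z zc; have /eqP/setP/(_ z) : [set z | d c z] == [set~ c].
  by rewrite eqEcard sub (eqP eqc) /=.
by rewrite !inE zc.
Qed.

Lemma source_no_in c : outdeg d c = n.-1 -> forall z, d z c = false.
Proof.
move/out_all=> all z; apply/negP=> zc.
by have := all z (arc_neq e_simple d_or zc); rewrite (or_asym d_or zc).
Qed.

Section Tight.
Hypothesis bridge_tight :
  forall E, E \in edges e -> E \notin cover (cycles e) -> w E = F.
Hypothesis cycles_triangles : forall C, C \in cycles e ->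
  exists x y z, [/\ transitive_triangle d x y z, C = cycle_edges [:: x; y; z],
    outdeg d y = 1%N & (outdeg d x + indeg d z = n.+1)%N].

(** An arc on no cycle is full itself. In a transitive triangle the arc from the
    source to the sink is full, and either [x] is the source of the triangle, or it
    is the middle vertex, which has out-degree 1. *)
Lemma arc_to_full x t : d x t -> exists u v, full_arc u v /\
  (u = x /\ (v = t \/ d t v) \/ outdeg d x = 1%N).
Proof.
move=> xt; have ext := or_arc d_or xt.
case: (boolP ([set x; t] \in cover (cycles e))) => [/bigcupP[C Cc xtC]|br].
  have [x' [y [z [tr CE oy oi]]]] := cycles_triangles Cc.
  have /and3P[x'y yz x'z] := tr.
  have gp := transitive_triangle_cycle e_simple d_or tr.
  have xzF : full_arc x' z.
    apply: full_arc_card => //; rewrite oi -addn1 leq_add2l.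
    (* The middle vertex is the only one between the source and the sink. *)
    rewrite -(cards1 y) subset_leq_card //.
    apply/subsetP=> v; rewrite !inE => /andP[x'v vz].
    have [vp|vp] := boolP (v \in [:: x'; y; z]).
      move: vp; rewrite !inE => /or3P[]// /eqP E; subst v.
        by move: (arc_neq e_simple d_or x'v); rewrite eqxx.
      by move: (arc_neq e_simple d_or vz); rewrite eqxx.
    have E : x' = z.
      apply: (cycle_outer_nbr e_sym e_cactus gp vp); rewrite ?inE ?eqxx ?orbT //.
        by rewrite e_sym (or_arc d_or).
      exact: (or_arc d_or).
    by move: (arc_neq e_simple d_or x'z); rewrite E eqxx.
  exists x', z; split=> //.
  have no u v : d u v -> d v u -> False by move=> /(or_asym d_or) ->.
  move: xtC; rewrite CE (triangle_edges gp) !inE => /orP[/orP[]|] /eqP/set2_inj[] [E1 E2]; subst.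
  - by left; auto.
  - by case: (no _ _ xt x'y).
  - by right.
  - by case: (no _ _ xt yz).
  - by left; auto.
  - by case: (no _ _ xt x'z).
exists x, t; split; last by left; auto.
apply: full_arc_card => //.
have xtE : [set x; t] \in edges e by rewrite mem_edges.
rewrite (bridge_weight_eq e_simple d_or ha xt br (bridge_tight xtE br)).
rewrite (_ : _ :&: _ = set0) ?cards0 ?addn0 //.
apply/setP=> z; rewrite !inE; apply/negP=> /andP[xz zt].
exact: (bridge_no_common e_simple d_or xt br xz zt).
Qed.

Lemma not_all_out c : outdeg d c <> n.-1 -> exists2 z, z != c & ~~ d c z.
Proof.
move=> no; case: (pickP [pred z | (z != c) && ~~ d c z]) => [z /andP[]|none].
  by exists z.
case: no; apply/out_all => z zc; apply/negPn/negP=> dcz.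
by have := none z; rewrite /= zc dcz.
Qed.

Lemma no_four_cycle x y z t : ~~ graph_cycle e [:: x; y; z; t].
Proof.
apply/negP=> gp; have Cc : cycle_edges [:: x; y; z; t] \in cycles e.
  by apply/cyclesP; exists [:: x; y; z; t].
have [x' [y' [z' [tr CE _ _]]]] := cycles_triangles Cc.
have gp' := transitive_triangle_cycle e_simple d_or tr.
by have := card_cycle_edges gp; rewrite CE (card_cycle_edges gp').
Qed.

End Tight.

Lemma exists_arc : (1 < n)%N -> exists x y, d x y.
Proof.
move=> n2; have : (0 < #|edges e|)%N.
  by rewrite (card_edges e_simple e_cactus) addn_gt0 -subn1 subn_gt0 n2.
by case/card_gt0P=> E /(edges_arcP d_or)[x [y [xy _]]]; exists x, y.
Qed.

End Extremal.

Section Reversal.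
Variables (T : finType) (e d : rel T).

Definition converse : rel T := fun x y => d y x.

Lemma orientation_converse : orientation e d -> orientation e converse.
Proof. by move=> or u v; have [H1 H2] := or u v; rewrite /converse orbC andbC. Qed.

Lemma randic_converse (R : realType) (a : R) :
  randic0_succ a converse = randic0_succ a d.
Proof.
rewrite /randic0_succ; congr (_ * _); rewrite (exchange_big_dep xpredT) //=.
by apply: eq_bigr => u _; apply: eq_bigr => v _; rewrite addrC.
Qed.

End Reversal.

Section Center.
Variables (T : finType) (e d : rel T).
Hypothesis e_simple : simple_graph e.
Hypothesis e_cactus : cactus e.
Hypothesis d_or : orientation e d.
Variables (R : realType) (a : R).

Let e_sym : symmetric e := e_simple.1.
Let e_irr : irreflexive e := e_simple.2.

Local Notation f k := (k%:R `^ a : R).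
Local Notation n := #|T|.
Local Notation F := (f n.-1 + 1).
Local Notation w := (edge_weight e d a).
Local Notation bound := (n.-1%:R * F + 2 * #|cycles e|%:R * f 2).

(** For [a = 1], a share equal to the degree means that all arcs at the vertex go in
    the same direction; the cycle uses up all the vertices, and it has no chord. *)
Lemma tight_C4 p : graph_cycle e p -> (3 < size p)%N -> a = 1 -> n = 4%N ->
  (forall x, x \in p -> half_weight d a x (next p x) = f (deg e x)) ->
  [/\ size p = 4%N, #|cycles e| = 1%N & sink_source d].
Proof.
move=> gp p4 a1 n4 H; have /and3P[_ _ Up] := gp.
have sp : size p = 4%N by have := cycle_size gp; lia.
have pT x : x \in p by apply: spanning_cycle gp _; rewrite n4.
split=> //.
  have := card_edges e_simple e_cactus; rewrite n4.
  have -> : edges e = cycle_edges p.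
    rewrite -(cycle_chordless e_sym e_cactus gp); congr (induced_edges e _).
    by apply/setP=> x; rewrite !inE pT.
  by rewrite (card_cycle_edges gp) sp; lia.
move=> x; have := H x (pT x).
rewrite /half_weight -(deg_out_in d_or) a1.
by case: ifP => _; rewrite !powRr1 ?ler0n // => /eqP; rewrite eqr_nat; [right|left]; lia.
Qed.

(** On an alternating 4-cycle with [a = 1] every edge has weight [2 + 2]. *)
Lemma C4_weight : a = 1 -> n = 4%N -> #|cycles e| = 1%N -> sink_source d ->
  (forall x, deg e x = 2%N) -> \sum_(E in edges e) w E = bound.
Proof.
move=> a1 n4 r1 ss deg2.
have wE E : E \in edges e -> w E = 4.
  case/(edges_arcP d_or)=> x [y [xy ->]].
  rewrite (arc_weightE e_simple d_or) //.
  have o1 := outdeg_gt0 xy; have i1 := indeg_gt0 xy.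
  have := deg2 x; have := deg2 y; rewrite -!(deg_out_in d_or).
  case: (ss x) (ss y) => [ox|ix] [oy|iy] Ey Ex; try by lia.
  have -> : outdeg d x = 2%N by lia.
  have -> : indeg d y = 2%N by lia.
  by rewrite a1 powRr1 ?ler0n // -natrD.
rewrite (eq_bigr _ wE) sumr_const (card_edges e_simple e_cactus) n4 r1 a1.
by rewrite !powRr1 ?ler0n //= -[4 *+ _]mulr_natl; ring.
Qed.

Hypothesis ha : 1 <= a.

(** Take a full arc from [u] to [v]. If [z] is not an out-neighbour of [u] and [t']
    not an in-neighbour of [v], then [t'] is an out-neighbour of [u]; the full arc
    attached to the arc from [u] to [t'] ends in some [v'] whose in-neighbours
    include [z], which closes the 4-cycle [u v' z v]. *)
Lemma tight_center : (0 < n)%N ->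
  (forall E, E \in edges e -> E \notin cover (cycles e) -> w E = F) ->
  (forall C, C \in cycles e ->
    exists x y z, [/\ transitive_triangle d x y z, C = cycle_edges [:: x; y; z],
      outdeg d y = 1%N & (outdeg d x + indeg d z = n.+1)%N]) ->
  exists c, outdeg d c = n.-1 \/ indeg d c = n.-1.
Proof.
move=> n0 Hb Hc.
have [n1|n2] := leqP n 1.
  have /card_gt0P[c _] := n0; exists c; left.
  apply/(out_all e_simple d_or) => z.
  have /card_le1_eqP n1' := n1.
  by rewrite (n1' z c) ?eqxx // inE.
have [x [t xt]] := exists_arc e_simple e_cactus d_or n2.
have [u [v [[uv fuv] _]]] := arc_to_full e_simple e_cactus d_or ha Hb Hc xt.
have d'_or := orientation_converse d_or.
have [outE|/eqP outE] := eqVneq (outdeg d u) n.-1; first by exists u; left.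
have [inE'|/eqP inE'] := eqVneq (indeg d v) n.-1; first by exists v; right.
exfalso.
have [z zu duz] := not_all_out e_simple d_or outE.
have [t' t'v dtv] := not_all_out e_simple d'_or inE'.
have zv : d z v by have := fuv z; rewrite (negPf duz).
have ut : d u t' by have := fuv t'; rewrite -[d t' v]/(converse d v t') (negPf dtv) orbF.
have [u' [v' [[uv' fuv'] [[uE tv]|o1]]]] :=
  arc_to_full e_simple e_cactus d_or ha Hb Hc ut; last first.
  have : [set v; t'] \subset [set y | d u y].
    by apply/subsetP=> y; rewrite !inE => /orP[]/eqP->.
  by move=> /subset_leq_card; rewrite cards2 eq_sym t'v -/(outdeg d u) o1.
subst u'; have zv' : d z v' by have := fuv' z; rewrite (negPf duz).
have vv' : v' != v.
  by case: tv => [->//|tv']; apply: contraNneq dtv => <-.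
have arc := or_arc d_or; have ne := arc_neq e_simple d_or.
have /negP[] := no_four_cycle e_simple d_or Hc u v' z v.
rewrite /graph_cycle /= !inE (arc _ _ uv') (arc _ _ zv).
rewrite [e v' z]e_sym (arc _ _ zv') [e v u]e_sym (arc _ _ uv) /=.
by rewrite !negb_or (ne _ _ uv') (ne _ _ uv) eq_sym zu vv' (eq_sym v') (ne _ _ zv') (ne _ _ zv).
Qed.

Section DominatingSource.
Variable c : T.
Hypothesis c_out : outdeg d c = n.-1.

Let c_all := (out_all e_simple d_or c).2 c_out.
Let in_c := source_no_in e_simple d_or c_out.

Lemma center_triangle x y : d x y -> x != c -> transitive_triangle d c x y.
Proof.
move=> xy xc; rewrite /transitive_triangle xy c_all // c_all //.
by apply: contraTneq xy => ->; rewrite in_c.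
Qed.

(** The bound on the degree sum of a triangle leaves no freedom once [c] has degree
    [n - 1]. *)
Lemma center_triangle_weight x y : transitive_triangle d c x y ->
  \sum_(E in cycle_edges [:: c; x; y]) w E = 2 * F + 2 * f 2.
Proof.
move=> tr; have gp := transitive_triangle_cycle e_simple d_or tr.
rewrite (triangle_weight d a gp).
have /and3P[cx xy cy] := tr.
rewrite !(arc_weightE e_simple d_or) // c_out.
have := triangle_deg e_simple e_cactus gp; rewrite -!(deg_out_in d_or) c_out.
have o1 := outdeg_gt0 xy; have i1 := indeg_gt0 cx.
have i2 : (2 <= indeg d y)%N.
  have <- : #|[set c; x]| = 2%N by rewrite cards2 (arc_neq e_simple d_or cx).
  by apply: subset_leq_card; apply/subsetP=> t; rewrite !inE => /orP[]/eqP->.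
move=> le; have n0 : (0 < n)%N by apply/card_gt0P; exists c.
have [-> -> ->] : [/\ outdeg d x = 1, indeg d x = 1 & indeg d y = 2]%N.
  by move: le; move: #|T| n0 => m n0 le; clear -le n0 o1 i1 i2; split; lia.
by rewrite pow1; ring.
Qed.

(** Every edge avoiding [c] closes a triangle with [c]. Thus an edge on no cycle goes
    from [c] to a vertex of in-degree 1, and a cycle, which has an edge avoiding [c],
    is the triangle on this edge. *)
Lemma center_weight : \sum_(E in edges e) w E = bound.
Proof.
apply/(weight_bound e_simple e_cactus d_or ha).2; split.
  move=> E /(edges_arcP d_or)[x [y [xy ->]]].
  have cov u v t : transitive_triangle d u v t ->
      [/\ [set u; v] \in cover (cycles e), [set v; t] \in cover (cycles e)
        & [set u; t] \in cover (cycles e)].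
    move=> tr; have [m1 m2 m3] := transitive_triangle_edges e_simple d_or tr.
    have gp := transitive_triangle_cycle e_simple d_or tr.
    have Cc : cycle_edges [:: u; v; t] \in cycles e.
      by apply/cyclesP; exists [:: u; v; t].
    by split; apply/bigcupP; exists (cycle_edges [:: u; v; t]).
  move=> br; have [xc|xc] := eqVneq x c; last first.
    by have [_ B _] := cov _ _ _ (center_triangle xy xc); rewrite B in br.
  subst x; rewrite (arc_weightE e_simple d_or) // c_out.
  suff -> : indeg d y = 1%N by rewrite pow1.
  apply/eqP/cards1P; exists c; apply/setP=> u; rewrite !inE.
  apply/idP/eqP=> [uy|->//]; apply/eqP/negP=> /negP uc.
  by have [_ _ B] := cov _ _ _ (center_triangle uy uc); rewrite B in br.
move=> C Cc; have /cyclesP[p [gp CE]] := Cc; have /and3P[p3 _ Up] := gp.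
have [x [xp xc nc]] : exists x, [/\ x \in p, x != c & next p x != c].
  have [cp|cp] := boolP (c \in p).
    exists (next p c); rewrite mem_next; split=> //.
      by rewrite eq_sym (edge_neq e_simple) // graph_cycle_next.
    apply: contra (next_neq_prev Up p3 cp) => /eqP E.
    by rewrite -{2}E prev_next.
  have [x xp] : exists x, x \in p.
    by case: p p3 {gp Up CE cp} => // x s; exists x; rewrite mem_head.
  exists x; split=> //; first by apply: contraNneq cp => <-.
  by apply: contraNneq cp => <-; rewrite mem_next.
have xnC : [set x; next p x] \in C by rewrite CE next_cycle_edges.
have {CE} [s [t [tr stC]]] : exists s t,
    transitive_triangle d c s t /\ [set s; t] \in C.
  have := graph_cycle_next gp xp; rewrite (or_edge d_or) => /orP[st|ts].
    by exists x, (next p x); split; rewrite // center_triangle.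
  by exists (next p x), x; split; rewrite ?center_triangle // setUC.
have gp' := transitive_triangle_cycle e_simple d_or tr.
have Tc : cycle_edges [:: c; s; t] \in cycles e by apply/cyclesP; exists [:: c; s; t].
have [_ m2 _] := transitive_triangle_edges e_simple d_or tr.
rewrite (cycles_disjoint e_simple e_cactus Cc Tc stC m2).
by rewrite center_triangle_weight // (card_cycle_edges gp').
Qed.

End DominatingSource.

End Center.

(** * Isomorphisms with the extremal orientations *)

Section ListIsomorphism.
Variables (T : finType) (e : rel T) (x0 : T).
Implicit Types d : rel T.

Lemma digraph_iso_converse d (T' : finType) (d' : rel T') :
  digraph_iso d d' -> digraph_iso (converse d) (converse d').
Proof. by case=> h hbij hE; exists h => // x y; apply: hE. Qed.

Lemma outdeg_iso d (T' : finType) (d' : rel T') (h : T -> T') :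
  bijective h -> (forall x y, d x y = d' (h x) (h y)) ->
  forall x, outdeg d x = outdeg d' (h x).
Proof.
case=> k hk kh hE x; rewrite /outdeg -(card_imset _ (can_inj hk)).
apply: eq_card => y; rewrite !inE; apply/imsetP/idP=> [[z + ->]|xy].
  by rewrite inE hE.
by exists (k y); rewrite ?inE ?kh // hE kh.
Qed.

Lemma indeg_iso d (T' : finType) (d' : rel T') (h : T -> T') :
  bijective h -> (forall x y, d x y = d' (h x) (h y)) ->
  forall x, indeg d x = indeg d' (h x).
Proof.
by move=> hbij hE; apply: (@outdeg_iso (converse d) _ (converse d')) => // x y;
  apply: hE.
Qed.

(** Numbering the vertices by their positions in a list transports the
    orientation. *)
Lemma list_iso d n (s : seq T) (G : rel 'I_n) : orientation e d ->
  uniq s -> size s = n -> (forall x, x \in s) ->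
  (forall x y (i j : 'I_n), index x s = i -> index y s = j -> e x y = G i j) ->
  exists d' : rel 'I_n, [/\ orientation G d', digraph_iso d d' &
    forall i j : 'I_n, d' i j = d (nth x0 s i) (nth x0 s j)].
Proof.
move=> or Us ss sT eG; subst n.
pose h (i : 'I_(size s)) := nth x0 s i.
exists (fun i j => d (h i) (h j)); split=> //.
  move=> i j; rewrite -(eG (h i) (h j)) ?index_uniq //; exact: or.
have lt x : (index x s < size s)%N by rewrite index_mem.
have hK x : h (Ordinal (lt x)) = x by rewrite /h /= nth_index.
exists (fun x => Ordinal (lt x)) => [|x y]; last by rewrite !hK.
by exists h => [x|i]; [rewrite hK|apply: val_inj; rewrite /= index_uniq].
Qed.

End ListIsomorphism.

Section Pairs.
Variable T : eqType.
Implicit Types (M : seq (T * T)).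

Definition pair_list M : seq T := flatten [seq [:: q.1; q.2] | q <- M].

Lemma size_pair_list M : size (pair_list M) = (size M).*2.
Proof. by elim: M => //= q M ->. Qed.

Lemma nth_pair_list x0 M k : (k < size M)%N ->
  nth x0 (pair_list M) k.*2 = (nth (x0, x0) M k).1 /\
  nth x0 (pair_list M) k.*2.+1 = (nth (x0, x0) M k).2.
Proof. by elim: M k => // q M IH [|k] //= /IH. Qed.

Lemma mem_pair_list M x :
  reflect (exists2 q, q \in M & x = q.1 \/ x = q.2) (x \in pair_list M).
Proof.
apply: (iffP flatten_mapP) => [[q qM xq]|[q qM xq]]; exists q => //.
  by move: xq; rewrite !inE => /orP[]/eqP->; auto.
by rewrite !inE; case: xq => ->; rewrite eqxx ?orbT.
Qed.

Lemma uniq_pair_list M : uniq M -> (forall q, q \in M -> q.1 != q.2) ->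
  (forall q q' x, q \in M -> q' \in M ->
     x = q.1 \/ x = q.2 -> x = q'.1 \/ x = q'.2 -> q = q') ->
  uniq (pair_list M).
Proof.
elim: M => //= q M IH /andP[qM UM] ne disj.
have qh : q \in q :: M := mem_head q M.
have out x : x = q.1 \/ x = q.2 -> x \notin pair_list M.
  move=> xq; apply/negP=> /mem_pair_list[q' q'M xq'].
  have q'M' : q' \in q :: M by rewrite inE q'M orbT.
  by move: qM; rewrite (disj q q' x qh q'M' xq xq') q'M.
rewrite inE negb_or (ne q qh) !out ?IH //; auto.
  by move=> q' q'M; apply: ne; rewrite inE q'M orbT.
by move=> q1 q2 x q1M q2M; apply: disj; rewrite inE ?q1M ?q2M orbT.
Qed.

End Pairs.

Section DominatedIsomorphism.
Variables (T : finType) (e d : rel T) (c : T).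
Hypothesis e_simple : simple_graph e.
Hypothesis e_cactus : cactus e.
Hypothesis d_or : orientation e d.
Hypothesis c_out : outdeg d c = #|T|.-1.

Let e_sym : symmetric e := e_simple.1.
Let e_irr : irreflexive e := e_simple.2.
Local Notation r := #|cycles e|.

Let c_all := (out_all e_simple d_or c).2 c_out.
Let in_c := source_no_in e_simple d_or c_out.

Let ec z : z != c -> e c z.
Proof. by move/c_all/(or_arc d_or). Qed.

(** Two different edges at [z] avoiding [c] would lie in two triangles sharing the
    edge from [c] to [z]. *)
Lemma center_matching z u v : z != c -> u != c -> v != c ->
  e z u -> e z v -> u = v.
Proof.
move=> zc uc vc zu zv; apply/eqP/negP=> /negP uv.
have gp : graph_cycle e [:: c; z; u].
  by apply: (triangle_cycle e_simple); rewrite ?ec.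
have vp : v \notin [:: c; z; u].
  by rewrite !inE !negb_or vc (eq_sym v z) (edge_neq e_simple zv) eq_sym uv.
have E : c = z.
  apply: (cycle_outer_nbr e_sym e_cactus gp vp); rewrite ?inE ?eqxx ?orbT //.
    by rewrite e_sym ec.
  by rewrite e_sym.
by rewrite E eqxx in zc.
Qed.

Definition outer_arcs : {set T * T} := [set q | d q.1 q.2 && (q.1 != c)].

Lemma outer_arcP q : q \in outer_arcs ->
  [/\ d q.1 q.2, q.1 != c & q.2 != c].
Proof.
rewrite inE => /andP[q12 qc]; split=> //.
by apply: contraTneq q12 => ->; rewrite in_c.
Qed.

(** There are [n - 1 + r] edges, and [n - 1] of them are at [c]. *)
Lemma card_outer_arcs : #|outer_arcs| = r.
Proof.
pose S := [set [set c; z] | z in [set~ c]].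
pose Q := [set [set q.1; q.2] | q in outer_arcs].
have cS : #|S| = #|T|.-1.
  rewrite card_in_imset ?cardsC1 // => x y; rewrite !inE => xc yc.
  by case/set2_inj=> [[_ ->]//|[E _]]; rewrite -E eqxx in yc.
have cQ : #|Q| = #|outer_arcs|.
  apply: card_in_imset => -[x y] [u v] /outer_arcP[/= xy _ _] /outer_arcP[/= uv _ _].
  case/set2_inj=> -[E1 E2]; subst=> //.
  by rewrite (or_asym d_or xy) in uv.
have SQ : edges e = S :|: Q.
  apply/setP=> E; rewrite inE; apply/idP/orP=> [|].
    case/(edges_arcP d_or)=> x [y [xy ->]].
    have [xc|xc] := eqVneq x c.
      left; apply/imsetP; exists y; rewrite ?inE ?xc //.
      by rewrite eq_sym -xc (arc_neq e_simple d_or).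
    by right; apply/imsetP; exists (x, y); rewrite ?inE /= ?xy.
  case=> /imsetP[q qP ->]; rewrite mem_edges //.
    by rewrite ec // -in_setC1.
  by case/outer_arcP: qP => /(or_arc d_or).
have SQ0 : S :&: Q = set0.
  apply/setP=> E; rewrite !inE; apply/negP=> /andP[/imsetP[z _ ->] /imsetP[q]].
  by case/outer_arcP=> _ q1 q2 /set2_inj[[E1 _]|[E1 _]]; rewrite E1 eqxx in q1 q2.
have := card_edges e_simple e_cactus.
by rewrite SQ cardsU SQ0 cards0 subn0 cS cQ => /addnI.
Qed.

(** List [c] first, then the two ends of each arc avoiding [c], then the remaining
    vertices: the positions are the vertices of [G0]. *)
Lemma dominated_iso n : #|T| = n ->
  exists2 d' : rel 'I_n, is_G1 r d' & digraph_iso d d'.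
Proof.
move=> Tn; pose M := enum outer_arcs.
have sM : size M = r by rewrite -cardE card_outer_arcs.
have MP q : q \in M -> [/\ d q.1 q.2, q.1 != c & q.2 != c].
  by rewrite mem_enum => /outer_arcP.
pose L := pair_list M; pose rest := enum [pred z | (z != c) && (z \notin L)].
pose s := c :: L ++ rest.
have UL : uniq L.
  apply: uniq_pair_list; first exact: enum_uniq.
    by move=> q /MP[/(arc_neq e_simple d_or)].
  move=> [x y] [u v] z /MP[/= xy xc yc] /MP[/= uv uc vc] zq zq'.
  have e1 := or_arc d_or xy; have e2 := or_arc d_or uv.
  case: zq zq' => -> [] E; subst.
  - by rewrite (center_matching xc yc vc e1 e2).
  - rewrite e_sym in e2; have E := center_matching xc yc uc e1 e2; subst.
    by rewrite (or_asym d_or xy) in uv.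
  - rewrite e_sym in e1; have E := center_matching yc xc vc e1 e2; subst.
    by rewrite (or_asym d_or xy) in uv.
  rewrite e_sym in e1; rewrite e_sym in e2.
  by rewrite (center_matching yc xc uc e1 e2).
have cL : c \notin L.
  by apply/negP=> /mem_pair_list[q /MP[_ q1 q2] [E|E]]; rewrite -E eqxx in q1 q2.
have Us : uniq s.
  rewrite /s /= mem_cat negb_or cL mem_enum !inE eqxx /= cat_uniq UL enum_uniq andbT /=.
  by apply/hasPn=> z; rewrite mem_enum inE => /andP[].
have sT x : x \in s.
  by rewrite inE mem_cat mem_enum inE; case: eqP => //= _; case: (x \in L).
have ss : size s = n by rewrite -Tn -(card_uniqP Us); apply: eq_card => x; rewrite sT.
have nthM k : (k < r)%N ->
    [/\ k.*2.+2 < size s, nth c s k.*2.+1 = (nth (c, c) M k).1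
      & nth c s k.*2.+2 = (nth (c, c) M k).2]%N.
  rewrite -sM => kM; have [n1 n2] := nth_pair_list c kM.
  have szL : (k.*2.+1 < size L)%N by rewrite size_pair_list -doubleS leq_double.
  by rewrite /s /= !nth_cat szL (ltnW szL) size_cat ltnS (leq_trans szL (leq_addr _ _)).
have posM k x y : (k < r)%N -> nth (c, c) M k = (x, y) ->
    index x s = k.*2.+1 /\ index y s = k.*2.+2.
  move=> kr E; have [lt n1 n2] := nthM k kr.
  have {}n1 : nth c s k.*2.+1 = x by rewrite n1 E.
  have {}n2 : nth c s k.*2.+2 = y by rewrite n2 E.
  by split; [rewrite -n1|rewrite -n2]; apply: index_uniq => //; apply: ltnW.
have index0 x : (index x s == 0%N) = (x == c).
  by rewrite /s /= [RHS]eq_sym; case: (c == x).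
have G1E (d' : rel 'I_n) (i j : 'I_n) :
    (forall i j : 'I_n, d' i j = d (nth c s i) (nth c s j)) ->
    i = 0%N :> nat -> j != 0%N :> nat -> d' i j.
  move=> d'E i0 j0; rewrite d'E i0; apply: c_all.
  by rewrite -index0 index_uniq // ss.
have [|d' [or' iso' d'E]] := @list_iso T e c d n s (@G0 n r) d_or Us ss sT; last first.
  exists d' => //; split=> // i j i0 ij; apply: G1E => //; apply/negP=> j0.
  move: ij; rewrite /G0 i0 (eqP j0) /=.
  by case/existsP=> k /=; rewrite ?andbF.
(* From here on only the positions matter; the body of [s] must not unfold. *)
clearbody s; move=> x y i j xi yj; rewrite /G0 -xi -yj !index0.
have no0 : (x == c) || (y == c) ->
    [exists k : 'I_r, ((index x s == k.*2.+1) && (index y s == k.*2.+2)) ||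
       ((index y s == k.*2.+1) && (index x s == k.*2.+2))] = false.
  move=> xy; apply/existsP=> -[k].
  by case/orP: xy; rewrite -index0 => /eqP->; rewrite ?andbF ?orbF /= ?andbF.
have [xc|xc] := eqVneq x c.
  rewrite no0 ?xc ?eqxx // orbF /=; case: eqVneq => [->|yc]; rewrite ?e_irr //.
  exact: ec.
have [yc|yc] := eqVneq y c.
  by rewrite no0 ?yc ?eqxx ?orbT // orbF /= e_sym ec.
rewrite /=; apply/idP/existsP=> [|[k]].
  have find u v : d u v -> u != c -> exists k : 'I_r,
      index u s = k.*2.+1 /\ index v s = k.*2.+2.
    move=> uv uc; have uvM : (u, v) \in M by rewrite mem_enum inE /= uv.
    have kr : (index (u, v) M < r)%N by rewrite -sM index_mem.
    by exists (Ordinal kr); apply: posM => //; rewrite nth_index.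
  rewrite (or_edge d_or) => /orP[/find|/find] [] // k [-> ->];
    by exists k; rewrite !eqxx ?orbT.
have edge u v : index u s = k.*2.+1 -> index v s = k.*2.+2 -> e u v.
  move=> uE vE; have [_ n1 n2] := nthM k (ltn_ord k).
  rewrite -(nth_index c (sT u)) -(nth_index c (sT v)) uE vE n1 n2.
  by apply: (or_arc d_or); case: (MP (nth (c, c) M k)); rewrite ?mem_nth ?sM.
by case/orP=> /andP[/eqP E1 /eqP E2]; [|rewrite e_sym]; apply: edge.
Qed.

End DominatedIsomorphism.

Section SquareIsomorphism.
Variables (T : finType) (e d : rel T).
Hypothesis e_simple : simple_graph e.
Hypothesis e_cactus : cactus e.
Hypothesis d_or : orientation e d.

Lemma square_iso p : graph_cycle e p -> size p = 4%N -> #|T| = 4%N ->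
  sink_source d -> exists2 d' : rel 'I_4, is_G34 d' & digraph_iso d d'.
Proof.
move=> gp p4 T4 ss; have /and3P[_ cp Up] := gp.
have e_sym := e_simple.1; have e_irr := e_simple.2.
have pT x : x \in p by apply: spanning_cycle gp _; rewrite T4.
case: p gp p4 cp Up pT => [|x0 [|x1 [|x2 [|x3 []]]]] // gp p4 cp Up pT.
have /and5P[e01 e12 e23 e30 _] := cp.
have [n01 n02 n03 [n12 n13 n23]] : [/\ x0 != x1, x0 != x2, x0 != x3 &
    [/\ x1 != x2, x1 != x3 & x2 != x3]].
  by move: Up; rewrite /= !inE !negb_or => /and4P[/and3P[-> -> ->] /andP[-> ->] ->].
have e02 : e x0 x2 = false.
  apply/negP=> /(cycle_nbr e_sym e_cactus gp (pT x0) (pT x2)).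
  rewrite prev_head /= ?eqxx; last by case/andP: Up.
  by case=> E; [move: n12|move: n23]; rewrite E eqxx.
have e13 : e x1 x3 = false.
  apply/negP=> /(cycle_nbr e_sym e_cactus gp (pT x1) (pT x3)).
  rewrite /= eqxx (eq_sym x1) (negPf n01).
  by case=> E; [move: n23|move: n03]; rewrite E eqxx.
have eE (i j : nat) : (i < 4)%N -> (j < 4)%N ->
    e (nth x0 [:: x0; x1; x2; x3] i) (nth x0 [:: x0; x1; x2; x3] j) =
    (i.+1 %% 4 == j)%N || (j.+1 %% 4 == i)%N.
  case: i => [|[|[|[|i]]]] // _; case: j => [|[|[|[|j]]]] //= _;
    by rewrite ?e_irr // ?e01 ?e12 ?e23 ?e30 // 1?e_sym ?e01 ?e12 ?e23 ?e30 ?e02 ?e13.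
have [|d' [or' iso' d'E]] := @list_iso T e x0 d 4 _ C4 d_or Up p4 pT.
  move=> x y i j xi yj; rewrite /C4 -eE // -xi -yj.
  by rewrite !nth_index.
exists d' => //; split=> // i; case: iso' => h hbij hE.
have [k hk kh] := hbij; rewrite -(kh i).
by rewrite -(outdeg_iso hbij hE) -(indeg_iso hbij hE).
Qed.

Lemma C4_nbrs (d' : rel 'I_4) : is_G34 d' -> digraph_iso d d' ->
  sink_source d /\ forall x, deg e x = 2%N.
Proof.
case=> or' ss' [h hbij hE]; split=> [x|x].
  by rewrite (outdeg_iso hbij hE) (indeg_iso hbij hE).
rewrite -(deg_out_in d_or) (outdeg_iso hbij hE) (indeg_iso hbij hE) (deg_out_in or').
rewrite /deg -sum1_card big_mkcond /=; move: (h x) => i.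
rewrite !big_ord_recl big_ord0 !inE /C4.
by case: i => [[|[|[|[|i]]]]].
Qed.

End SquareIsomorphism.

Lemma is_G1_outdeg n r (d : rel 'I_n) (T : finType) (d0 e0 : rel T) :
  (0 < n)%N -> simple_graph e0 -> orientation e0 d0 ->
  is_G1 r d -> digraph_iso d0 d -> exists c, outdeg d0 c = #|T|.-1.
Proof.
case: n d => // n d _ simple0 or0 [orG G1] [h [k hk kh] hE].
exists (k ord0); apply/(out_all simple0 or0) => z zc.
rewrite hE kh; apply: G1 => //; rewrite /G0 /=.
suff -> : (h z == 0 :> nat)%N = false by [].
by apply: contraNF zc => /eqP h0; rewrite -(hk z); apply/eqP; congr k; apply: val_inj.
Qed.

Lemma is_G2_converse n r (d : rel 'I_n) : is_G2 r d <-> is_G1 r (converse d).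
Proof.
split=> -[or G]; split; try exact: G; first exact: orientation_converse.
exact: orientation_converse or.
Qed.

Theorem theorem3p1 (R : realType) (n r : nat) (a : R) (T : finType)
  (e d : rel T) (hn : (1 <= n)%N) (ha : 1 <= a)
  (hG : cactus_class n r e) (hD : orientation e d) :
  let bound : R :=
    2^-1 * ((n%:R - 1) `^ (a + 1) + n%:R - 1 + 2 * r%:R * 2 `^ a) in
  randic0_succ a d <= bound /\
  (randic0_succ a d = bound <-> Gstar a n r d).
Proof.
case: hG => simple0 cactus0 Tn cr bound.
have n0 : (0 < #|T|)%N by rewrite Tn.
have bE : bound = 2^-1 * (#|T|.-1%:R * (#|T|.-1%:R `^ a + 1)
                          + 2 * #|cycles e|%:R * 2%:R `^ a).
  rewrite /bound Tn cr; congr (_ * (_ + _)).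
  have -> : n%:R - 1 = n.-1%:R :> R by rewrite -subn1 natrB.
  rewrite -addrA; have -> : n%:R - 1 = n.-1%:R :> R by rewrite -subn1 natrB.
  rewrite -(mulr_powRB1 (p := a + 1)) ?ler0n ?addrK ?mulrDr ?mulr1 //.
  by rewrite ltr_wpDl // (le_trans _ ha).
have d'_or := orientation_converse hD.
have half (x y : R) : 2^-1 * x = 2^-1 * y <-> x = y.
  by split=> [E|-> //]; apply: mulfI E; rewrite invr_eq0 pnatr_eq0.
have center (d0 : rel T) c : orientation e d0 -> outdeg d0 c = #|T|.-1 ->
    randic0_succ a d0 = bound.
  move=> or0 c_out; rewrite (randic_edge_sum simple0 or0) bE; apply/half.
  exact: (center_weight simple0 cactus0 or0 ha c_out).
have [le eq] := weight_bound simple0 cactus0 hD ha.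
split; first by rewrite (randic_edge_sum simple0 hD) bE ler_pM2l // invr_gt0 ltr0n.
split.
  rewrite {1}(randic_edge_sum simple0 hD) bE => /half/eq[Hb Hc].
  have tight C : C \in cycles e -> tight_cycle e d a C.
    by move=> Cc; apply: (cycle_weight simple0 cactus0 hD ha Cc).2; apply: Hc.
  have [[C [Cc [p [gp CE p4 a1 [n4 H]]]]]|none] := pselect (exists C, C \in cycles e /\
      exists p, [/\ graph_cycle e p, C = cycle_edges p, (3 < size p)%N, a = 1 &
        #|T| = 4%N /\ forall x, x \in p ->
          half_weight d a x (next p x) = (deg e x)%:R `^ a]).
    have [sp r1 ss] := tight_C4 simple0 cactus0 hD gp p4 a1 n4 H.
    apply: Or33; split=> //; first by rewrite -Tn -cr n4 r1.
    exact: (square_iso simple0 cactus0 hD gp).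
  have Ht C : C \in cycles e -> exists x y z, [/\ transitive_triangle d x y z,
      C = cycle_edges [:: x; y; z], outdeg d y = 1%N
      & (outdeg d x + indeg d z = #|T|.+1)%N].
    by move=> Cc; case: (tight C Cc) => // H; case: none; exists C.
  have [c [oc|ic]] := tight_center simple0 cactus0 hD ha n0 Hb Ht; rewrite -cr.
    by apply: Or31; apply: (dominated_iso simple0 cactus0 hD oc).
  have [d' G1 iso] := dominated_iso simple0 cactus0 d'_or ic Tn.
  apply: Or32; exists (converse d'); last exact: digraph_iso_converse iso.
  exact/is_G2_converse.
case=> [[d' G1 iso]|[d' G2 iso]|[a1 [n4 r1] [d' G34 iso]]].
- by have [c c_out] := is_G1_outdeg hn simple0 hD G1 iso; apply: center c_out.
- rewrite -randic_converse.
  have [c c_out] := is_G1_outdeg hn simple0 d'_or ((is_G2_converse _ _).1 G2)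
    (digraph_iso_converse iso).
  exact: center c_out.
have [ss deg2] := C4_nbrs hD G34 iso.
rewrite (randic_edge_sum simple0 hD) bE; apply/half.
by apply: (C4_weight simple0 cactus0 hD) => //; rewrite ?Tn ?cr.
Qed.
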